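(* The problems IB-SM Probabilistic Lobbying and IB-AM Probabilistic Lobbying (issue bribery with strict-majority, respectively average-majority, evaluation, as defined in the context) are decidable in polynomial time.
   Context: Probabilistic lobbying setting. There are $m$ voters $v_1,\dots,v_m$ and $n$ issues $r_1,\dots,r_n$. A probability matrix $P=(p_{i,j})\in(\mathbb{Q}\cap[0,1])^{m\times n}$ gives the probability that $v_i$ votes ''yes'' on $r_j$. A discretization level $k\in\mathbb{N}$ is chosen so that $k+1$ is a common multiple of the denominators of all $p_{i,j}$; admissible probability values are $0,\frac1{k+1},\dots,1$. For each $(i,j)$ a price function $c_{i,j}:\{0,\frac1{k+1},\dots,1\}\to\mathbb{N}$ with $c_{i,j}(p_{i,j})=0$, monotone in the sense that $p_{i,j}\le a\le b$ or $p_{i,j}\ge a\ge b$ implies $c_{i,j}(a)\le c_{i,j}(b)$, gives the price of changing $v_i$'s probability on $r_j$ to $a$; these form a cost matrix $C_P$ with $mn$ rows and $k+2$ columns. The Lobby has a target vector $\vec Z\in\{0,1\}^n$ and integer budget $B$; a threshold $t\in\mathbb{Q}\cap[0,1]$ is given. Voter $v_i$ favors the agenda on $r_j$ if his probability of voting $Z_j$ ($p_{i,j}$ if $Z_j=1$, $1-p_{i,j}$ if $Z_j=0$) exceeds $t$. Strict majority (SM): $r_j$ is won iff strictly more than $m/2$ voters favor the agenda on it. Average majority (AM): $r_j$ is won iff the average over voters of the probability of voting $Z_j$ exceeds $t$. Issue bribery (IB): The Lobby chooses an amount $d_j\ge0$ for each issue $r_j$, with $\sum_j d_j\le B$; the amount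 $d_j$ is distributed equally among all $m$ voters, and each voter's probability on $r_j$ moves in the direction of $Z_j$ to the farthest admissible value $a$ with $c_{i,j}(a)\le d_j/m$. IB-Y Probabilistic Lobbying ($Y\in\{SM,AM\}$): given $P,C_P,\vec Z,B$ (and $t$), decide whether some issue bribery within budget $B$ makes every issue won under criterion $Y$. *)

(* Defs.v *)
From mathcomp Require Import all_boot all_order all_algebra.

Set Implicit Arguments.
Unset Strict Implicit.
Unset Printing Implicit Defensive.

Import Order.TTheory GRing.Theory Num.Theory.
Local Open Scope ring_scope.

(** * Deterministic multi-tape Turing machines and the class P *)

Inductive move := MoveLeft | MoveRight | Stay.

(* Tape alphabet: [None] is the blank, [Some (inl a)] an input symbol,
   [Some (inr g)] an auxiliary symbol. *)
Notation tape_symbol A G := (option (A + G)%type).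

(* There are [tm_tapes.+1] tapes; tape [ord0] carries the input. *)
Record tm (A : finType) := TM {
  tm_tapes : nat;
  tm_state : finType;
  tm_aux : finType;
  tm_start : tm_state;
  (* [None]: still running; [Some b]: halted with answer [b]. *)
  tm_verdict : tm_state -> option bool;
  tm_trans : tm_state -> {ffun 'I_tm_tapes.+1 -> tape_symbol A tm_aux} ->
    tm_state * {ffun 'I_tm_tapes.+1 -> tape_symbol A tm_aux * move} }.

(* A two-way infinite tape, blank outside of the two lists; [tape_left] is
   listed from the head outwards. *)
Record tape (G : Type) := Tape {
  tape_left : seq (option G);
  tape_head : option G;
  tape_right : seq (option G) }.

Definition tape_of (G : Type) (s : seq (option G)) : tape G :=
  Tape [::] (head None s) (behead s).

Definition tape_write (G : Type) (g : option G) (t : tape G) : tape G :=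
  Tape (tape_left t) g (tape_right t).

Definition tape_move (G : Type) (d : move) (t : tape G) : tape G :=
  let: Tape l g r := t in
  match d with
  | MoveLeft => Tape (behead l) (head None l) (g :: r)
  | MoveRight => Tape (g :: l) (head None r) (behead r)
  | Stay => t
  end.

Record tm_config (A : finType) (M : tm A) := TMConfig {
  cfg_state : tm_state M;
  cfg_tapes : 'I_(tm_tapes M).+1 -> tape (A + tm_aux M)%type }.

Definition tm_init (A : finType) (M : tm A) (w : seq A) : tm_config M :=
  TMConfig (tm_start M)
    (fun i => tape_of (if i == ord0 then [seq Some (inl a) | a <- w] else [::])).

Definition tm_step (A : finType) (M : tm A) (c : tm_config M) : tm_config M :=
  if tm_verdict (cfg_state c) is Some _ then c else
  let: (q, act) :=
    tm_trans (cfg_state c) [ffun i => tape_head (cfg_tapes c i)] in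
  TMConfig q
    (fun i => tape_move (act i).2 (tape_write (act i).1 (cfg_tapes c i))).

Definition tm_run (A : finType) (M : tm A) (w : seq A) (s : nat) :
    tm_config M :=
  iter s (@tm_step A M) (tm_init M w).

Definition tm_decides_in_time (A : finType) (M : tm A) (L : seq A -> Prop)
    (T : nat -> nat) : Prop :=
  forall w : seq A, exists s : nat, exists b : bool,
    [/\ (s <= T (size w))%N,
        tm_verdict (cfg_state (tm_run M w s)) = Some b &
        b <-> L w].

Definition polytime_decidable (A : finType) (L : seq A -> Prop) : Prop :=
  exists (M : tm A) (c e : nat),
    tm_decides_in_time M L (fun l => c * l ^ e + c)%N.

(** * Probabilistic lobbying *)

(* [grid_value a] is the admissible probability a / (k + 1). *)
Definition grid_value (k : nat) (a : 'I_k.+2) : rat := a%:R / k.+1%:R.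

Record lobbying := Lobbying {
  voters : nat;
  issues : nat;
  level : nat;
  voters_gt0 : (0 < voters)%N;
  prob : 'M[rat]_(voters, issues);
  prob_in01 : forall i j, 0 <= prob i j <= 1;
  prob_admissible : forall i j, (denq (prob i j) %| (level.+1)%:Z)%Z;
  (* [price i j a] is c_{i,j} (a / (level + 1)). *)
  price : 'I_voters -> 'I_issues -> 'I_level.+2 -> nat;
  price_start : forall i j a, grid_value a = prob i j -> price i j a = 0%N;
  price_mono : forall i j a b,
    (prob i j <= grid_value a <= grid_value b) ||
    (grid_value b <= grid_value a <= prob i j) ->
    (price i j a <= price i j b)%N;
  target : 'I_issues -> bool;
  budget : int;
  threshold : rat;
  threshold_in01 : 0 <= threshold <= 1 }.

Arguments price : clear implicits.
Arguments target : clear implicits.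

(* The probability of the vote [z] when "yes" has probability [p]. *)
Definition vote_prob (z : bool) (p : rat) : rat := if z then p else 1 - p.

Definition favors (x : lobbying) (P : 'M[rat]_(voters x, issues x))
    (i : 'I_(voters x)) (j : 'I_(issues x)) : bool :=
  threshold x < vote_prob (target x j) (P i j).

Inductive criterion := StrictMajority | AverageMajority.

Definition won (Y : criterion) (x : lobbying)
    (P : 'M[rat]_(voters x, issues x)) (j : 'I_(issues x)) : bool :=
  match Y with
  | StrictMajority =>
      (voters x)%:R / 2%:R < #|[set i | favors P i j]|%:R :> rat
  | AverageMajority =>
      threshold x <
        (\sum_(i < voters x) vote_prob (target x j) (P i j)) / (voters x)%:R
  end.

Definition affordable (x : lobbying) (d : 'I_(issues x) -> rat)
    (i : 'I_(voters x)) (j : 'I_(issues x)) (a : 'I_(level x).+2) : bool :=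
  (price x i j a)%:R <= d j / (voters x)%:R.

(* [prob x i j] is itself an affordable admissible value when [0 <= d j], so
   using it as the default of the big operators adds nothing. *)
Definition bribed (x : lobbying) (d : 'I_(issues x) -> rat) :
    'M[rat]_(voters x, issues x) :=
  \matrix_(i, j)
    if target x j then
      \big[Order.max/prob x i j]_(a < (level x).+2 |
          (prob x i j <= grid_value a) && affordable d i j a) grid_value a
    else
      \big[Order.min/prob x i j]_(a < (level x).+2 |
          (grid_value a <= prob x i j) && affordable d i j a) grid_value a.

Definition IB_lobbying (Y : criterion) (x : lobbying) : Prop :=
  exists d : 'I_(issues x) -> rat,
    [/\ forall j, 0 <= d j,
        \sum_(j < issues x) d j <= (budget x)%:~R &
        forall j, won Y (bribed d) j].

(** * Instances as words *)

(* [Some b] is the bit [b], [None] is the separator ending a numeral. *)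
Definition symbol : finType := option bool.

Fixpoint bin_succ (s : seq bool) : seq bool :=
  match s with
  | [::] => [:: true]
  | false :: s' => true :: s'
  | true :: s' => false :: bin_succ s'
  end.

(* Binary, least significant bit first, without superfluous zeros. *)
Definition bin_digits (n : nat) : seq bool := iter n bin_succ [::].

Definition nat_code (n : nat) : seq symbol :=
  rcons [seq Some b | b <- bin_digits n] None.

Definition int_code (z : int) : seq symbol := Some (z < 0) :: nat_code `|z|%N.

(* Fractions need not be in lowest terms, so a nonnegative rational has
   several codes. *)
Definition is_rat_code (q : rat) (u : seq symbol) : Prop :=
  exists a b : nat,
    [/\ (0 < b)%N, q = a%:R / b%:R & u = nat_code a ++ nat_code b].

(* [P] is listed row by row; the price table has one line of [level + 2]
   entries for each pair (i, j), the lines being in the same order. *)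
Definition is_lobbying_code (x : lobbying) (w : seq symbol) : Prop :=
  exists (pc : 'I_(voters x) -> 'I_(issues x) -> seq symbol)
         (tc : seq symbol),
    [/\ forall i j, is_rat_code (prob x i j) (pc i j),
        is_rat_code (threshold x) tc &
        w = nat_code (voters x) ++ nat_code (issues x) ++ nat_code (level x)
          ++ flatten [seq pc i j | i <- enum 'I_(voters x),
                                   j <- enum 'I_(issues x)]
          ++ flatten [seq flatten [seq nat_code (price x i j a)
                                  | a <- enum 'I_(level x).+2]
                     | i <- enum 'I_(voters x), j <- enum 'I_(issues x)]
          ++ [seq Some (target x j) | j <- enum 'I_(issues x)]
          ++ int_code (budget x)
          ++ tc].

(* The words that code a yes-instance; malformed words are outside. *)
Definition IB_language (Y : criterion) (w : seq symbol) : Prop :=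
  exists x : lobbying, is_lobbying_code x w /\ IB_lobbying Y x.

(* Main.v *)
Require Import Defs.
From mathcomp Require Import all_boot all_order all_algebra.
From mathcomp Require Import zify ring.
From Stdlib Require Import FunctionalExtensionality.

(** Winning an issue only depends on which prices are at most d_j / m, and it
is monotone in d_j; hence the cheapest winning amount for the issue r_j is m
times one of the numerals of the input word, and the instance is a yes-instance
iff the sum of these minima is within the budget.  This criterion, as well as
well-formedness of the word, can be written with sums, products and comparisons
of natural numbers, where all summation indices are bounded by the length of
the word.  Such an expression has polynomially many bits, and a loop that is
only allowed to run for |w| + 2 rounds, however deeply nested, takes polynomial
time; so it suffices to evaluate the expression with such loops on the stacks
of a multi-tape Turing machine. *)

Set Implicit Arguments.
Unset Strict Implicit.
Unset Printing Implicit Defensive.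

(** * Structured programs for Turing machines *)

(** The running time is to follow from syntax alone. No loop of a [prog] looks at the data, so its
    nesting depth is the degree of the time bound and no invariant has to enter the cost analysis.
    The price is that every numeral needs a width known in advance. With N = |w| + 2, a term of rank
    D has all its values below 2^(N^D), and D nested loops run exactly N^D rounds, one for each
    digit. Bounding the indices by |w| is sound although m, n and k are written in binary: the word
    lists P and the price table entry by entry, so one entry suffices to force m, n and k below |w|.
    If n = 0, then m and k can be exponentially large, but no entry is ever visited. The farthest
    affordable probability is a maximum or minimum, which terms lack. Prices are monotone, so it can
    be found by counting affordable unit steps. Likewise the cheapest winning numeral is a sum in
    which a single summand survives. *)

Definition cell := tape_symbol symbol void.
Definition tapes := nat -> tape (symbol + void)%type.

Inductive cmd :=
| Act of nat & (cell -> cell * move)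
| Seq of cmd & cmd
| If of nat & (cell -> bool) & cmd & cmd
| While of nat & (cell -> bool) & cmd.

(** Control points, built from finite types so that they can serve as machine states. The added
    [None] of [If] and [While] is the point where the test is made. *)
Fixpoint pos (c : cmd) : finType :=
  match c with
  | Act _ _ => unit
  | Seq a b => (pos a + pos b)%type
  | If _ _ a b => option (pos a + pos b)%type
  | While _ _ a => option (pos a)
  end.

Fixpoint entry_pos (c : cmd) : pos c :=
  match c with
  | Act _ _ => tt
  | Seq a b => inl (entry_pos a)
  | If _ _ a b => None
  | While _ _ a => None
  end.

(* One transition: the next position ([None] is the exit) and the action on
   the only tape that is touched. *)
Fixpoint cstep (c : cmd) :
    pos c -> (nat -> cell) -> option (pos c) * (nat * (cell * move)) :=
  match c with
  | Act r f => fun _ h => (None, (r, f (h r)))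
  | Seq a b => fun q h =>
      match q with
      | inl q => let: (q', x) := cstep q h in
                 (Some (if q' is Some q' then inl q' else inr (entry_pos b)), x)
      | inr q => let: (q', x) := cstep q h in (omap inr q', x)
      end
  | If r p a b => fun q h =>
      match q with
      | None => (Some (Some (if p (h r) then inl (entry_pos a)
                             else inr (entry_pos b))), (r, (h r, Stay)))
      | Some (inl q) => let: (q', x) := cstep q h in
                        (omap (fun q => Some (inl q)) q', x)
      | Some (inr q) => let: (q', x) := cstep q h in
                        (omap (fun q => Some (inr q)) q', x)
      end
  | While r p a => fun q h =>
      match q with
      | None => (if p (h r) then Some (Some (entry_pos a)) else None,
                 (r, (h r, Stay)))
      | Some q => let: (q', x) := cstep q h in (Some q', x)
      end
  end.

Definition act_on (x : nat * (cell * move)) (tau : tapes) : tapes :=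
  fun i => if i == x.1 then tape_move x.2.2 (tape_write x.2.1 (tau i))
           else tau i.

Definition heads (tau : tapes) : nat -> cell := fun i => tape_head (tau i).

Inductive steps (c : cmd) : pos c -> tapes -> nat -> tapes -> Prop :=
| steps_exit q tau x : cstep q (heads tau) = (None, x) ->
    steps q tau 1 (act_on x tau)
| steps_next q q' tau x t tau' : cstep q (heads tau) = (Some q', x) ->
    steps q' (act_on x tau) t tau' -> steps q tau t.+1 tau'.

Definition runs c tau t tau' := steps (entry_pos c) tau t tau'.

Lemma act_on_stay r tau : act_on (r, (heads tau r, Stay)) tau = tau.
Proof.
apply: functional_extensionality => i; rewrite /act_on /=.
by case: eqP => // ->; rewrite /heads; case: (tau r).
Qed.

Lemma runs_act r f tau : runs (Act r f) tau 1 (act_on (r, f (heads tau r)) tau).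
Proof. exact: steps_exit. Qed.

Lemma runs_seq a b tau t tau' t' tau'' :
  runs a tau t tau' -> runs b tau' t' tau'' ->
  runs (Seq a b) tau (t + t') tau''.
Proof.
rewrite /runs /= => Ha Hb.
have Hb' : steps (c := Seq a b) (inr (entry_pos b)) tau' t' tau''.
  elim: Hb => {tau tau' tau'' t t' Ha} [q tau x E|q q' tau x t tau' E _ IH].
    by apply: steps_exit; rewrite /= E.
  by apply: steps_next IH; rewrite /= E.
elim: Ha Hb' => {tau tau' t Hb} [q tau x E|q q' tau x t tau' E _ IH] Hb.
  by apply: steps_next Hb; rewrite /= E.
by apply: steps_next (IH Hb); rewrite /= E.
Qed.

Lemma runs_if r p a b tau t tau' :
  runs (if p (heads tau r) then a else b) tau t tau' ->
  runs (If r p a b) tau t.+1 tau'.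
Proof.
move=> H; apply: (@steps_next (If r p a b) None _ tau (r, (heads tau r, Stay)));
  first by [].
rewrite act_on_stay; case: (p _) H => H.
  elim: H => {tau tau' t} [q tau x E|q q' tau x t tau' E _ IH].
    by apply: steps_exit; rewrite /= E.
  by apply: steps_next IH; rewrite /= E.
elim: H => {tau tau' t} [q tau x E|q q' tau x t tau' E _ IH].
  by apply: steps_exit; rewrite /= E.
by apply: steps_next IH; rewrite /= E.
Qed.

Lemma runs_while_false r p a tau : p (heads tau r) = false ->
  runs (While r p a) tau 1 tau.
Proof.
move=> E; rewrite -[X in runs _ _ _ X](act_on_stay r).
by apply: steps_exit; rewrite /= E.
Qed.

Lemma runs_while_true r (p : cell -> bool) a tau t tau' t' tau'' : p (heads tau r) ->
  runs a tau t tau' -> runs (While r p a) tau' t' tau'' ->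
  runs (While r p a) tau (t + t').+1 tau''.
Proof.
move=> E Ha Hw.
apply: (@steps_next (While r p a) None (Some (entry_pos a)) tau
  (r, (heads tau r, Stay))); first by rewrite /= E.
rewrite act_on_stay; elim: Ha Hw => {tau tau' t E} [q tau x E|q q' tau x t tau' E _ IH] Hw.
  by apply: steps_next Hw; rewrite /= E.
by apply: steps_next (IH Hw); rewrite /= E.
Qed.

Fixpoint tape_bound (c : cmd) : nat :=
  match c with
  | Act r _ => r
  | Seq a b => maxn (tape_bound a) (tape_bound b)
  | If r _ a b => maxn r (maxn (tape_bound a) (tape_bound b))
  | While r _ a => maxn r (tape_bound a)
  end.

(** Commands act on infinitely many tapes, a machine on finitely many. Cutting off at [K] is
    harmless because no transition reads a head beyond [tape_bound c]. *)
Lemma cstep_ext K c (q : pos c) h h' : tape_bound c <= K ->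
  (forall i, i <= K -> h i = h' i) -> cstep q h = cstep q h'.
Proof.
move=> HK E; elim: c q HK => [r f|a IHa b IHb|r p a IHa b IHb|r p a IHa] q /=.
- by move=> HK; rewrite E.
- rewrite geq_max => /andP[Ha Hb]; case: q => q; by [rewrite IHa | rewrite IHb].
- rewrite !geq_max => /and3P[Hr Ha Hb]; case: q => [[]|] => [q|q|].
  + by rewrite IHa.
  + by rewrite IHb.
  + by rewrite E.
- rewrite geq_max => /andP[Hr Ha]; case: q => [q|]; first by rewrite IHa.
  by rewrite E.
Qed.

(** * Commands as Turing machines *)

Section CmdTM.

Variables (c : cmd) (o : nat).
Let K := maxn o (tape_bound c).

Definition cmd_trans (q : (pos c + option bool)%type)
    (h : {ffun 'I_K.+1 -> tape_symbol symbol void}) :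
    (pos c + option bool)%type *
    {ffun 'I_K.+1 -> tape_symbol symbol void * move} :=
  match q with
  | inl p => let: (p', x) := cstep p (fun i => h (inord i)) in
      (if p' is Some p' then inl p' else inr None,
       [ffun i : 'I_K.+1 => if i == x.1 :> nat then x.2 else (h i, Stay)])
  | inr _ => (inr (Some (h (inord o) == Some (inl (Some true)))),
              [ffun i : 'I_K.+1 => (h i, Stay)])
  end.

(* When the command exits, the verdict is read off the head of tape [o]. *)
Definition cmd_tm : tm symbol :=
  @TM symbol K (pos c + option bool)%type void (inl (entry_pos c))
    (fun q => if q is inr b then b else None) cmd_trans.

Definition restrict (tau : tapes) : 'I_K.+1 -> tape (symbol + void)%type :=
  fun i => tau i.

Lemma cmd_tm_steps q tau t tau' : @steps c q tau t tau' ->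
  iter t (@tm_step symbol cmd_tm) (@TMConfig symbol cmd_tm (inl q) (restrict tau))
  = @TMConfig symbol cmd_tm (inr None) (restrict tau').
Proof.
have step1 q1 tau1 q2 x : cstep q1 (heads tau1) = (q2, x) ->
    tm_step (@TMConfig symbol cmd_tm (inl q1) (restrict tau1)) =
    @TMConfig symbol cmd_tm (if q2 is Some p' then inl p' else inr None)
      (restrict (act_on x tau1)).
  move=> E; rewrite /tm_step /=.
  rewrite (@cstep_ext K _ _ _ (heads tau1)) ?leq_maxr //; last first.
    by move=> i Hi; rewrite ffunE /restrict /heads inordK.
  rewrite E; congr TMConfig; apply: functional_extensionality => i.
  rewrite !ffunE /restrict /act_on; case: eqP => //= _.
  by case: (tau1 i).
elim=> {q tau t tau'} [q tau x E|q q' tau x t tau' E _ IH].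
  by rewrite /= (step1 _ _ _ _ E).
by rewrite iterSr (step1 _ _ _ _ E).
Qed.

(** The additional step leads from the exit state [inr None] to the state that records the symbol
    under the head of tape [o]. *)
Lemma cmd_tm_decides tau t tau' (w : seq symbol) :
  restrict tau = cfg_tapes (tm_init cmd_tm w) ->
  runs c tau t tau' ->
  tm_verdict (cfg_state (tm_run cmd_tm w t.+1)) =
  Some (heads tau' o == Some (inl (Some true))).
Proof.
move=> E /cmd_tm_steps H; rewrite /tm_run iterS.
have -> : tm_init cmd_tm w = @TMConfig symbol cmd_tm (inl (entry_pos c)) (restrict tau).
  by rewrite E.
rewrite H /tm_step /= !ffunE.
by rewrite /restrict inordK // ltnS leq_maxl.
Qed.

End CmdTM.

(** * Stack programs with clocked loops *)

Definition store := nat -> seq symbol.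

Definition upd (s : store) (r : nat) (v : seq symbol) : store :=
  fun i => if i == r then v else s i.

Inductive prog :=
| Skip
| Push of nat & symbol
| Pop of nat
| Then of prog & prog
| Test of nat & (option symbol -> bool) & prog & prog
| Loop of prog.

Fixpoint exec (N : nat) (c : prog) (s : store) : store :=
  match c with
  | Skip => s
  | Push r a => upd s r (a :: s r)
  | Pop r => upd s r (behead (s r))
  | Then a b => exec N b (exec N a s)
  | Test r p a b => if p (ohead (s r)) then exec N a s else exec N b s
  | Loop a => iter N (exec N a) s
  end.

Definition mk (a : symbol) : cell := Some (inl a).
Definition unmk (g : cell) : option symbol :=
  if g is Some (inl a) then Some a else None.

(** Tapes are not normalised: popping and moving back leave explicit blanks in both lists, so
    padding of any length is allowed. *)
Definition holds (t : tape (symbol + void)%type) (v : seq symbol) : Prop :=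
  exists p q, tape_left t = nseq p None /\
    tape_head t :: tape_right t = map mk v ++ nseq q None.

Lemma unmk_head t v : holds t v -> unmk (tape_head t) = ohead v.
Proof.
by case: t => l h r [p [q [_ /=]]]; case: v => [|a v] /=; case: q => [|q] // [->].
Qed.

Fixpoint depth (c : prog) : nat :=
  match c with
  | Then a b | Test _ _ a b => maxn (depth a) (depth b)
  | Loop a => (depth a).+1
  | _ => 0
  end.

Definition rewind r : cmd :=
  Seq (Act r (fun g => (g, MoveLeft)))
    (Seq (While r (@isSome _) (Act r (fun g => (g, MoveLeft))))
       (Act r (fun g => (g, MoveRight)))).

(* The stack [r] is held by tape [2 r], its top under the head.  A loop of
   depth [d] counts its rounds by moving along the ruler, tape [2 d + 1]. *)
Fixpoint compile (c : prog) : cmd :=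
  match c with
  | Skip => Act 0 (fun g => (g, Stay))
  | Push r a => Seq (Act r.*2 (fun g => (g, MoveLeft)))
                    (Act r.*2 (fun=> (mk a, Stay)))
  | Pop r => Act r.*2 (fun=> (None, MoveRight))
  | Then a b => Seq (compile a) (compile b)
  | Test r p a b => If r.*2 (fun g => p (unmk g)) (compile a) (compile b)
  | Loop a =>
      let r := (depth a).*2.+1 in
      Seq (While r (@isSome _)
             (Seq (compile a) (Act r (fun g => (g, MoveRight)))))
          (rewind r)
  end.

(** In a loop, each round pays for the test, the body and one move along the ruler, and later for
    two steps of rewinding. The last 4 is the failing test plus the three fixed steps of
    [rewind]. *)
Fixpoint cost (c : prog) (N : nat) : nat :=
  match c with
  | Push _ _ => 2
  | Then a b => cost a N + cost b N
  | Test _ _ a b => (cost a N + cost b N).+1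
  | Loop a => N * (cost a N + 4) + 4
  | _ => 1
  end.

(** The coefficient of N^depth in the bound on [cost]; the 8 absorbs the 4 N + 4 of a loop. *)
Fixpoint weight (c : prog) : nat :=
  match c with
  | Push _ _ => 2
  | Then a b => weight a + weight b
  | Test _ _ a b => (weight a + weight b).+1
  | Loop a => weight a + 8
  | _ => 1
  end.

Lemma cost_le c N : 0 < N -> cost c N <= weight c * N ^ depth c.
Proof.
move=> N0; elim: c => [|r a|r|a IHa b IHb|r p a IHa b IHb|a IHa] //=.
- have Ha := leq_pexp2l N0 (leq_maxl (depth a) (depth b)).
  have Hb := leq_pexp2l N0 (leq_maxr (depth a) (depth b)).
  by rewrite mulnDl leq_add // ?(leq_trans IHa) ?(leq_trans IHb) // leq_mul2l
    ?Ha ?Hb orbT.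
- have Ha := leq_pexp2l N0 (leq_maxl (depth a) (depth b)).
  have Hb := leq_pexp2l N0 (leq_maxr (depth a) (depth b)).
  rewrite -addn1 -[in leqRHS]addn1 2!mulnDl mul1n leq_add ?expn_gt0 ?N0 //.
  by rewrite leq_add // ?(leq_trans IHa) ?(leq_trans IHb) // leq_mul2l
    ?Ha ?Hb orbT.
have Nd : 0 < N ^ depth a by rewrite expn_gt0 N0.
rewrite expnS; nia.
Qed.

Definition set_tape (tau : tapes) r t : tapes :=
  fun i => if i == r then t else tau i.

Lemma act_onE r g d tau :
  act_on (r, (g, d)) tau = set_tape tau r (tape_move d (tape_write g (tau r))).
Proof.
by apply: functional_extensionality => i; rewrite /act_on /set_tape /=; case: eqP => // ->.
Qed.

Lemma set_tapeK tau r t t' : set_tape (set_tape tau r t) r t' = set_tape tau r t'.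
Proof.
by apply: functional_extensionality => i; rewrite /set_tape; case: eqP.
Qed.

Lemma set_tapeE tau r t : set_tape tau r t r = t.
Proof. by rewrite /set_tape eqxx. Qed.

Lemma runs_move r d tau :
  runs (Act r (fun g => (g, d))) tau 1 (set_tape tau r (tape_move d (tau r))).
Proof.
have := @runs_act r (fun g => (g, d)) tau; rewrite act_onE.
by rewrite /heads; case: (tau r).
Qed.

Lemma rewind_run tau r (u : seq symbol) (p : nat) g rest :
  tau r = Tape (map mk u ++ nseq p None) g rest ->
  exists p' t, t <= 2 * size u + 3 /\
    runs (rewind r) tau t
     (set_tape tau r (Tape (nseq p' None)
        (head None (map mk (rev u) ++ g :: rest))
        (behead (map mk (rev u) ++ g :: rest)))).
Proof.
move=> E; pose tau1 := set_tape tau r (tape_move MoveLeft (tau r)).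
have R1 : runs (Act r (fun g => (g, MoveLeft))) tau 1 tau1.
  exact: runs_move.
have loop : forall u tau rest,
    (tau r = let l := map mk u ++ nseq p None in
      Tape (behead l) (head None l) rest) ->
    runs (While r (@isSome _) (Act r (fun g => (g, MoveLeft)))) tau (2 * size u).+1
      (set_tape tau r (Tape (behead (nseq p None)) None (map mk (rev u) ++ rest))).
  elim=> [|a u' IH] tau2 rest2 E2.
    have E2' : tau2 r = Tape (behead (nseq p None)) None rest2.
      by rewrite E2 /=; case: (p).
    rewrite /= -E2'.
    have -> : set_tape tau2 r (tau2 r) = tau2.
      by apply: functional_extensionality => i; rewrite /set_tape; case: eqP => // ->.
    by apply: runs_while_false; rewrite /heads E2'.
  have -> : (2 * size (a :: u')).+1 = (1 + (2 * size u').+1).+1 by rewrite /=; lia.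
  apply: (runs_while_true (tau' := set_tape tau2 r (tape_move MoveLeft (tau2 r)))).
  - by rewrite /heads E2.
  - exact: runs_move.
  - have := IH (set_tape tau2 r (tape_move MoveLeft (tau2 r))) (mk a :: rest2).
    rewrite set_tapeE set_tapeK rev_cons -cats1 map_cat /= -catA /=; apply.
    by rewrite E2.
(* The scan stops on the blank to the left of [u], either a recorded one or one beyond the end of
   the list. The final move to the right records it again, hence [p.-1.+1]. *)
exists p.-1.+1, (1 + ((2 * size u).+1 + 1)); split => //; first lia.
apply: (runs_seq R1); apply: runs_seq.
  apply: (loop u _ (g :: rest)); rewrite /tau1 set_tapeE E //=.
set tau2 := set_tape _ _ _.
have := runs_move r MoveRight tau2.
rewrite /tau2 /tau1 set_tapeE !set_tapeK /=; by case: (p).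
Qed.

Lemma head_behead (T : Type) (x : T) s : 0 < size s -> head x s :: behead s = s.
Proof. by case: s. Qed.

Lemma holds_push t v a : holds t v ->
  holds (tape_write (mk a) (tape_move MoveLeft t)) (a :: v).
Proof.
case: t => l h r [p [q [/= -> E]]]; exists p.-1, q; split; first by case: (p).
by rewrite /= E.
Qed.

Lemma holds_pop t v : holds t v ->
  holds (tape_move MoveRight (tape_write None t)) (behead v).
Proof.
case: t => l h r [p [q [/= -> E]]]; exists p.+1.
case: v E => [|a v] /=; case: q => [|q] // [_ ->].
- by exists (maxn q 1); split => //; case: q => [|[]].
- rewrite cats0; case: v => [|b v]; first by exists 1.
  by exists 0; rewrite cats0.
- exists q.+1; split => //; by case: v.
Qed.

Definition regs (tau : tapes) (s : store) := forall r, holds (tau r.*2) (s r).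

Definition rulers (tau : tapes) D N :=
  forall d, d < D -> holds (tau d.*2.+1) (nseq N None).

(** While the body of a loop runs, the head of the loop's own ruler stands in its middle, where
    [rulers] fails. What protects it is that a program of depth [D] leaves all rulers from [D] on
    alone. *)
Definition same_rulers (tau tau' : tapes) D :=
  forall d, D <= d -> tau' d.*2.+1 = tau d.*2.+1.

Definition compile_ok c N := forall tau s, regs tau s -> rulers tau (depth c) N ->
  exists tau' t, [/\ runs (compile c) tau t tau', t <= cost c N,
    regs tau' (exec N c s), rulers tau' (depth c) N &
    same_rulers tau tau' (depth c)].

Lemma doubleS_neq a b : (a.*2 == b.*2.+1) = false.
Proof. by apply/eqP => /(congr1 odd) /=; rewrite !odd_double. Qed.

Lemma eq_double a b : (a.*2 == b.*2) = (a == b).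
Proof. by rewrite -!muln2 eqn_pmul2r. Qed.

Lemma set_reg tau s r t v : regs tau s -> holds t v ->
  regs (set_tape tau r.*2 t) (upd s r v).
Proof.
move=> R H i; rewrite /set_tape /upd eq_double; case: eqP => // _; exact: R.
Qed.

Lemma rulersW tau D D' N : D' <= D -> rulers tau D N -> rulers tau D' N.
Proof. by move=> H R d Hd; apply: R; apply: leq_trans H. Qed.

Lemma same_rulers_holds tau tau' D D' N :
  same_rulers tau tau' D -> rulers tau' D N -> rulers tau D' N -> rulers tau' D' N.
Proof.
move=> S R1 R2 d Hd; case: (ltnP d D) => H; first exact: R1.
by rewrite S //; exact: R2.
Qed.

(** Induction on the rounds still to go: [i] marks of the ruler lie behind the head and [j] from the
    head on. *)
Lemma compile_loop a N tau s p q i j : compile_ok a N -> i + j = N ->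
  let r := (depth a).*2.+1 in
  regs tau s -> rulers tau (depth a) N ->
  tape_left (tau r) = nseq i (mk None) ++ nseq p None ->
  tape_head (tau r) :: tape_right (tau r) = nseq j (mk None) ++ nseq q None ->
  exists tau' t q', [/\
    runs (While r (@isSome _) (Seq (compile a) (Act r (fun g => (g, MoveRight)))))
      tau t tau', t <= j * (cost a N + 2) + 1,
    regs tau' (iter j (exec N a) s),
    rulers tau' (depth a) N /\ same_rulers tau tau' (depth a).+1 &
    tau' r = Tape (nseq N (mk None) ++ nseq p None) None (nseq q' None)].
Proof.
move=> IH + r; elim: j i tau s q => [|j IHj] i tau s q Eij R Ru El Er.
  exists tau, 1, q.-1; split => //.
  - by apply: runs_while_false; rewrite /heads; move: Er; case: (q) => //= n [->].
  - by move: Er El; rewrite -Eij addn0; case: (tau r) => l h rt /=;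
      case: (q) => //= n [-> ->] ->.
have [tau1 [t1 [R1 T1 S1 Ru1 Sm1]]] := IH _ _ R Ru.
have Er1 : tau1 r = tau r by rewrite Sm1.
pose tau2 := set_tape tau1 r (tape_move MoveRight (tau1 r)).
have E2r : tau2 r = Tape (nseq i.+1 (mk None) ++ nseq p None)
    (head None (tape_right (tau r))) (behead (tape_right (tau r))).
  rewrite /tau2 set_tapeE Er1; move: El Er; case: (tau r) => l h rt /= ->.
  by case=> ->.
have Rt : tape_right (tau r) = nseq j (mk None) ++ nseq q None.
  by move: Er; case: (tau r) => l h rt [_ ->].
have [q2 E2] : exists q2, tape_head (tau2 r) :: tape_right (tau2 r) =
    nseq j (mk None) ++ nseq q2 None.
  rewrite E2r Rt /=; case: (j) => [|j'] /=; last by exists q.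
  by case: (q) => [|q']; [exists 1 | exists q'.+1].
have R2 : regs tau2 (exec N a s).
  move=> i'; rewrite /tau2 /set_tape doubleS_neq; exact: S1.
have Ru2 : rulers tau2 (depth a) N.
  move=> d Hd; rewrite /tau2 /set_tape eqSS eq_double ltn_eqF //; exact: Ru1.
have El2 : tape_left (tau2 r) = nseq i.+1 (mk None) ++ nseq p None by rewrite E2r.
have [|tau' [t' [q' [R' T' S' [Ru' Sm'] E']]]] := IHj i.+1 tau2 _ q2 _ R2 Ru2 El2 E2.
  by rewrite -Eij addnS.
exists tau', (t1 + 1 + t').+1, q'; split => //.
- apply: runs_while_true R'.
    by rewrite /heads; move: Er => /= [->].
  by apply: runs_seq R1 _; exact: runs_move.
- by rewrite mulSn; lia.
- by rewrite iterSr.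
- split=> // d Hd; rewrite Sm' // /tau2 /set_tape eqSS eq_double gtn_eqF // Sm1 //.
  exact: ltnW.
Qed.

Lemma compileP c N : compile_ok c N.
Proof.
elim: c => [|r a|r|a IHa b IHb|r p a IHa b IHb|a IHa] tau s R Ru.
- exists tau, 1; split => //=; have := runs_move 0 Stay tau.
  by rewrite (_ : set_tape _ _ _ = tau) //; apply: functional_extensionality => i;
    rewrite /set_tape; case: eqP => // ->; case: (tau 0).
- exists (set_tape tau r.*2 (tape_write (mk a) (tape_move MoveLeft (tau r.*2)))), 2.
  split => //=; last first.
  - by move=> d _; rewrite /set_tape eq_sym doubleS_neq.
  - by apply: set_reg => //; apply: holds_push.
  rewrite (_ : 2 = 1 + 1) //; apply: runs_seq (runs_move _ _ _) _.
  have := @runs_act r.*2 (fun=> (mk a, Stay))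
    (set_tape tau r.*2 (tape_move MoveLeft (tau r.*2))).
  rewrite act_onE set_tapeK set_tapeE /=; by case: (tape_move _ _).
- exists (set_tape tau r.*2 (tape_move MoveRight (tape_write None (tau r.*2)))), 1.
  split => //=; last first.
  - by move=> d _; rewrite /set_tape eq_sym doubleS_neq.
  - by apply: set_reg => //; apply: holds_pop.
  by have := @runs_act r.*2 (fun=> (None, MoveRight)) tau; rewrite act_onE.
- have [tau1 [t1 [R1 T1 S1 Ru1 Sm1]]] := IHa _ _ R (rulersW (leq_maxl _ _) Ru).
  have Ru1' := same_rulers_holds Sm1 Ru1 Ru.
  have [tau2 [t2 [R2 T2 S2 Ru2 Sm2]]] := IHb _ _ S1 (rulersW (leq_maxr _ _) Ru1').
  exists tau2, (t1 + t2); split => //=.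
  - exact: runs_seq R1 R2.
  - exact: leq_add.
  - exact: same_rulers_holds Sm2 Ru2 Ru1'.
  - by move=> d; rewrite geq_max => /andP[Ha Hb]; rewrite Sm2 // Sm1.
- have Ep : p (unmk (heads tau r.*2)) = p (ohead (s r)) by rewrite (unmk_head (R r)).
  have [|] := boolP (p (ohead (s r))) => Hp.
  + have [tau1 [t1 [R1 T1 S1 Ru1 Sm1]]] := IHa _ _ R (rulersW (leq_maxl _ _) Ru).
    exists tau1, t1.+1; split => //=.
    * by apply: runs_if; rewrite Ep Hp.
    * by rewrite ltnS (leq_trans T1) // leq_addr.
    * by rewrite Hp.
    * exact: same_rulers_holds Sm1 Ru1 Ru.
    * by move=> d; rewrite geq_max => /andP[Ha Hb]; rewrite Sm1.
  + have [tau1 [t1 [R1 T1 S1 Ru1 Sm1]]] := IHb _ _ R (rulersW (leq_maxr _ _) Ru).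
    exists tau1, t1.+1; split => //=.
    * by apply: runs_if; rewrite Ep (negbTE Hp).
    * by rewrite ltnS (leq_trans T1) // leq_addl.
    * by rewrite (negbTE Hp).
    * exact: same_rulers_holds Sm1 Ru1 Ru.
    * by move=> d; rewrite geq_max => /andP[Ha Hb]; rewrite Sm1.
have [p [q [El Er]]] := Ru (depth a) (ltnSn _).
have Ru0 : rulers tau (depth a) N by apply: rulersW Ru.
rewrite map_nseq in Er.
have [tau1 [t1 [q1 [R1 T1 S1 [Ru1 Sm1] E1]]]] :=
  compile_loop IHa (add0n N) R Ru0 El Er.
rewrite -[nseq N _](map_nseq N mk) in E1.
have [p2 [t2 [T2 R2]]] := rewind_run E1.
eexists; exists (t1 + t2); split; first exact: runs_seq R1 R2.
- by move: T2; rewrite size_nseq /=; lia.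
- by move=> i; rewrite /set_tape doubleS_neq; exact: S1.
- move=> d; rewrite ltnS leq_eqVlt /set_tape eqSS eq_double => /predU1P[->|Hd].
    rewrite eqxx; exists p2, q1.+1; split=> //.
    rewrite [LHS]head_behead ?size_cat ?addnS //.
    by rewrite rev_nseq ?map_nseq.
  by rewrite ltn_eqF //; exact: Ru1.
- move=> d Hd; rewrite /set_tape eqSS eq_double gtn_eqF //; exact: Sm1.
Qed.

(** * Building the rulers from the input *)

Definition mark r d : cmd := Act r (fun=> (mk None, d)).

(** The two marks beyond the length of the word make the number of rounds at least 2 even for the
    empty word, so a numeral always has room for two digits once its width exponent is positive. *)
Definition build_ruler r : cmd :=
  Seq (While 0 (@isSome _)
         (Seq (mark r MoveRight) (Act 0 (fun g => (g, MoveRight)))))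
    (Seq (Seq (mark r MoveRight) (mark r MoveRight)) (Seq (rewind r) (rewind 0))).

Lemma runs_mark r d tau : runs (mark r d) tau 1
  (set_tape tau r (tape_move d (tape_write (mk None) (tau r)))).
Proof. by have := @runs_act r (fun=> (mk None, d)) tau; rewrite act_onE. Qed.

Lemma build_ruler_run r tau (w : seq symbol) : 0 < r ->
  holds (tau 0) w -> tau r = tape_of [::] ->
  exists tau' t, [/\ runs (build_ruler r) tau t tau', t <= 7 * size w + 20,
    holds (tau' 0) w, holds (tau' r) (nseq (size w).+2 None) &
    forall i, 0 < i -> i != r -> tau' i = tau i].
Proof.
move=> r0 [p [q [El Er]]] Er0.
have loop : forall v q u k tau,
    tape_left (tau 0) = map mk u ++ nseq p None ->
    tape_head (tau 0) :: tape_right (tau 0) = map mk v ++ nseq q None ->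
    tau r = Tape (nseq k (mk None)) None [::] ->
    exists tau' q', [/\
      runs (While 0 (@isSome _)
         (Seq (mark r MoveRight) (Act 0 (fun g => (g, MoveRight)))))
        tau (3 * size v + 1) tau',
      tau' 0 = Tape (map mk (catrev v u) ++ nseq p None) None (nseq q' None),
      tau' r = Tape (nseq (k + size v) (mk None)) None [::] &
      forall i, 0 < i -> i != r -> tau' i = tau i].
  elim=> [|a v IH] {Er}q u k tau1 E1l E1r E1.
    exists tau1, q.-1; split => //.
    - by apply: runs_while_false; rewrite /heads; move: E1r; case: (q) => //= n [->].
    - by move: E1l E1r; case: (tau1 0) => l h rt /= ->; case: (q) => //= n [-> ->].
    - by rewrite addn0.
  pose tau2 := set_tape tau1 r (Tape (nseq k.+1 (mk None)) None [::]).
  pose tau3 := set_tape tau2 0 (tape_move MoveRight (tau2 0)).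
  have E20 : tau2 0 = tau1 0 by rewrite /tau2 /set_tape ltn_eqF.
  have [q2 E3r] : exists q2, tape_head (tau3 0) :: tape_right (tau3 0) =
      map mk v ++ nseq q2 None.
    rewrite /tau3 set_tapeE E20; case: (tau1 0) E1r => l h rt /= [_ ->].
    case: (v) => [|b v'] /=; last by exists q.
    by case: (q) => [|q']; [exists 1 | exists q'.+1].
  have [|||tau' [q' [R' E0' Er' S']]] := IH q2 (a :: u) k.+1 tau3.
  - rewrite /tau3 set_tapeE E20; case: (tau1 0) E1l E1r => l h rt /= ->.
    by case=> ->.
  - exact: E3r.
  - by rewrite /tau3 /tau2 /set_tape gtn_eqF // eqxx.
  exists tau', q'; split => //.
  - have -> : 3 * size (a :: v) + 1 = (1 + 1 + (3 * size v + 1)).+1 by rewrite /=; lia.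
    apply: runs_while_true R'.
      by rewrite /heads; move: E1r => /= [->].
    apply: runs_seq; last exact: runs_move.
    by rewrite /tau2; have := runs_mark r MoveRight tau1; rewrite E1.
  - by rewrite Er' addSnnS.
  - by move=> i i0 ir; rewrite S' // /tau3 /tau2 /set_tape gtn_eqF // (negbTE ir).
have [tau1 [q1 [R1 E10 E1r S1]]] := loop w q [::] 0 tau El Er Er0.
pose tau2 := set_tape tau1 r (Tape (nseq (size w).+2 (mk None)) None [::]).
have R2 : runs (Seq (mark r MoveRight) (mark r MoveRight)) tau1 (1 + 1) tau2.
  apply: runs_seq (runs_mark _ _ _) _.
  by have := runs_mark r MoveRight (set_tape tau1 r (tape_move MoveRight
    (tape_write (mk None) (tau1 r)))); rewrite set_tapeE set_tapeK E1r.
have E2r : tau2 r = Tape (map mk (nseq (size w).+2 None) ++ nseq 0 None) None [::].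
  by rewrite /tau2 set_tapeE cats0 map_nseq.
have [p3 [t3 [T3 R3]]] := rewind_run E2r.
set tau3 := set_tape tau2 r _ in R3.
have E30 : tau3 0 = Tape (map mk (rev w) ++ nseq p None) None (nseq q1 None).
  by rewrite /tau3 /tau2 /set_tape !ltn_eqF.
have [p4 [t4 [T4 R4]]] := rewind_run E30.
eexists; exists (3 * size w + 1 + (1 + 1 + (t3 + t4))); split.
- apply: runs_seq R1 _; apply: runs_seq R2 _; exact: runs_seq R3 R4.
- by move: T3 T4; rewrite size_nseq size_rev; lia.
- rewrite set_tapeE revK; exists p4, q1.+1; split => //=.
  by rewrite head_behead ?size_cat ?addnS.
- rewrite /set_tape (gtn_eqF r0) /tau3 set_tapeE rev_nseq; exists p3, 1.
  by rewrite !map_nseq.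
- move=> i i0 ir; rewrite /tau3 /tau2 /set_tape gtn_eqF // (negbTE ir).
  exact: S1.
Qed.

Fixpoint build_rulers D : cmd :=
  if D is D'.+1 then Seq (build_rulers D') (build_ruler D'.*2.+1)
  else Act 0 (fun g => (g, Stay)).

Lemma build_rulers_run D tau (w : seq symbol) :
  holds (tau 0) w -> (forall i, 0 < i -> tau i = tape_of [::]) ->
  exists tau' t, [/\ runs (build_rulers D) tau t tau',
    t <= D * (7 * size w + 20) + 1, holds (tau' 0) w,
    rulers tau' D (size w).+2 &
    forall i, 0 < i -> (forall d, d < D -> i != d.*2.+1) ->
      tau' i = tape_of [::]].
Proof.
move=> H0 Hi; elim: D => [|D [tau1 [t1 [R1 T1 E1 Ru1 S1]]]].
  exists tau, 1; split => //; last by move=> i i0 _; exact: Hi.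
  have := runs_move 0 Stay tau; rewrite (_ : set_tape _ _ _ = tau) //.
  apply: functional_extensionality => i.
  by rewrite /set_tape; case: eqP => // ->; case: (tau 0).
have [||tau2 [t2 [R2 T2 E2 Ru2 S2]]] := @build_ruler_run D.*2.+1 tau1 w _ E1 _.
- by [].
- by apply: S1 => // d Hd; rewrite eqSS eq_double gtn_eqF.
exists tau2, (t1 + t2); split => //.
- exact: runs_seq R1 R2.
- by rewrite mulSn; lia.
- move=> d; rewrite ltnS leq_eqVlt => /predU1P[->|Hd] //.
  by rewrite S2 ?eqSS ?eq_double ?ltn_eqF //; exact: Ru1.
- move=> i i0 Hd; rewrite S2 ?Hd // S1 // => d HdD; apply: Hd.
  exact: ltnW.
Qed.

Definition init_store (w : seq symbol) : store :=
  fun r => if r == 0 then w else [::].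

Theorem prog_polytime (c : prog) (o : nat) (L : seq symbol -> Prop) :
  (forall w, ohead (exec (size w).+2 c (init_store w) o) = Some (Some true)
     <-> L w) ->
  polytime_decidable L.
Proof.
move=> HL; pose D := depth c.
pose m := Seq (build_rulers D) (compile c).
(* With l = |w|, each ruler costs 7 l + 20, at most 27 (l + 2); the 2 pays for the initial idle step
   of [build_rulers] and for the verdict. The power of 3 comes from l + 2 <= 3 l for positive l; the
   additive constant of the time bound covers l = 0. *)
pose C := (27 * D + weight c + 2) * 3 ^ D.+1.
exists (cmd_tm m o.*2), C, D.+1 => w.
pose tau0 : tapes := fun i =>
  if i == 0 then tape_of [seq mk a | a <- w] else tape_of [::].
have h0 : holds (tau0 0) w.
  by case: w @tau0 => [|a w] tau0; [exists 0, 1 | exists 0, 0; rewrite cats0].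
have [|tau1 [t1 [R1 T1 E1 Ru1 S1]]] := @build_rulers_run D tau0 w h0.
  by case.
have Rg1 : regs tau1 (init_store w).
  case=> [|r] //; rewrite /init_store /= S1 ?double_gt0 //; first by exists 0, 1.
  by move=> d _; rewrite doubleS_neq.
have [tau2 [t2 [R2 T2 S2 Ru2 _]]] := compileP Rg1 Ru1.
have R := runs_seq R1 R2.
exists (t1 + t2).+1, (ohead (exec (size w).+2 c (init_store w) o) == Some (Some true)).
split.
- have T2' := leq_trans T2 (cost_le c (ltn0Sn _)).
  set l := size w in T1 T2' *.
  have H1 : (l.+2 ^ D.+1 <= 3 ^ D.+1 * (l ^ D.+1 + 1))%N.
    case: l {T1 T2'} => [|l]; first by rewrite exp0n // muln1 leq_exp2r.
    apply: (@leq_trans ((3 * l.+1) ^ D.+1)); first by rewrite leq_exp2r //; lia.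
    by rewrite expnMn leq_mul2l addn1 leqnSn orbT.
  have H2 : (l.+2 ^ D <= l.+2 ^ D.+1)%N by rewrite leq_exp2l.
  have H3 : (l.+2 <= l.+2 ^ D.+1)%N by rewrite -[X in X <= _]expn1 leq_exp2l.
  have H4 : (t1 + t2).+1 <= (27 * D + weight c + 2) * l.+2 ^ D.+1.
    have : weight c * l.+2 ^ D <= weight c * l.+2 ^ D.+1 by rewrite leq_mul2l H2 orbT.
    have : D * (7 * l + 20) <= D * (27 * l.+2 ^ D.+1) by rewrite leq_mul2l; apply/orP; right; lia.
    rewrite -/D in T2'; set X := l.+2 ^ D.+1 in H3 *; nia.
  apply: (leq_trans H4); apply: (@leq_trans ((27 * D + weight c + 2) * (3 ^ D.+1 * (l ^ D.+1 + 1)))).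
    by rewrite leq_mul2l H1 orbT.
  by rewrite mulnA -/C mulnDr muln1.
- rewrite (cmd_tm_decides (tau := tau0) _ R); last first.
    apply: functional_extensionality => i; rewrite /restrict /tau0 /=.
  by rewrite -(inj_eq val_inj) /=; case: ifP.
  rewrite -(unmk_head (S2 o)) /heads.
  by case: (tape_head _) => [[a|[]]|].
- by rewrite -HL; split=> [/eqP|->].
Qed.

(** * Compiling bounded arithmetical terms *)

Ltac reg_cases := rewrite /upd;
  repeat match goal with
  | |- context [if @eq_op _ ?a ?b then _ else _] => case: (@eqP _ a b) => ?
  end; subst => //; try (exfalso; congruence); try (exfalso; lia).

Ltac store_eq := apply: functional_extensionality => ?; reg_cases.

Ltac uniq_tac := rewrite /= ?inE ?negb_or ?andbT;
  repeat (apply/andP; split); apply/eqP; first [congruence | lia].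

Ltac split_uniq U := rewrite /= ?inE ?negb_or ?andbT in U;
  repeat match goal with
  | H : is_true (_ && _) |- _ => case/andP: H => ? ?
  | H : is_true (_ != _) |- _ => move/eqP in H
  end.

Definition loops D c := iter D Loop c.

Lemma iter_mul (T : Type) m n (f : T -> T) x : iter (m * n) f x = iter m (iter n f) x.
Proof. by elim: m => //= m IH; rewrite mulSn iterD IH. Qed.

Lemma exec_loops N D c s : exec N (loops D c) s = iter (N ^ D) (exec N c) s.
Proof.
elim: D s => [|D IH] s //=; rewrite expnS iter_mul.
by apply: eq_iter.
Qed.

(** The branching is on a symbol known when the program is written, so a step can be given as a Rocq
    function of the symbol that was read. *)
Definition read a (f : option symbol -> prog) : prog :=
  let test x := Test a (fun y => y == Some x) (f (Some x)) in
  test (Some true) (test (Some false) (test None (f None))).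

Lemma exec_then N a b s : exec N (Then a b) s = exec N b (exec N a s).
Proof. by []. Qed.

Lemma exec_read N a f s : exec N (read a f) s = exec N (f (ohead (s a))) s.
Proof. by rewrite /=; case: (ohead _) => [[[]|]|]. Qed.

(* Numbers are stored with a fixed width, so that every digit loop has the same
   length and no operation has to look for the end of a numeral. *)
Fixpoint bits (W x : nat) : seq symbol :=
  if W is W'.+1 then Some (odd x) :: bits W' x./2 else [::].

Lemma size_bits W x : size (bits W x) = W.
Proof. by elim: W x => //= W IH x; rewrite IH. Qed.

Lemma bits0 W : bits W 0 = nseq W (Some false).
Proof. by elim: W => //= W ->. Qed.

Lemma size_catrev (T : Type) (s t : seq T) : size (catrev s t) = size s + size t.
Proof. by rewrite catrevE size_cat size_rev. Qed.

(** One column of binary addition: the last summand is the carry out, the majority of the three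
    bits. *)
Lemma half_sum a b (k : bool) : (a + b + k)./2 =
  a./2 + b./2 + ((odd a && odd b) || (k && (odd a || odd b))).
Proof.
rewrite -[in LHS](odd_double_half a) -[in LHS](odd_double_half b) -!muln2.
move: (odd a) (odd b) a./2 b./2 => oa ob x y.
have half_eq (r : bool) m n : n = r + m * 2 -> n./2 = m.
  by move=> ->; rewrite muln2 half_bit_double.
by apply: (half_eq (oa (+) ob (+) k)); case: oa; case: ob; case: k => /=; lia.
Qed.

(** Comparison from the lowest digit upwards. The flag [k] tells whether the digits already removed
    are in the order <=; if they are not, the remaining parts must be strictly ordered. *)
Lemma half_leq a b (k : bool) :
  (a./2 + ~~ ((~~ odd a && odd b) || ((odd a == odd b) && k)) <= b./2) =
  (a + ~~ k <= b).
Proof.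
rewrite -[in RHS](odd_double_half a) -[in RHS](odd_double_half b) -!muln2.
move: (odd a) (odd b) a./2 b./2 => oa ob x y.
by case: oa; case: ob; case: k => /=; lia.
Qed.

Lemma modn_exp2S n x : x %% 2 ^ n.+1 = (x./2 %% 2 ^ n).*2 + odd x.
Proof.
have H := ltn_pmod x./2 (expn_gt0 2 n : 0 < 2 ^ n).
rewrite -[in LHS](odd_double_half x) [in LHS](divn_eq x./2 (2 ^ n)) expnS.
rewrite doubleD addnCA -muln2 -mulnA [2 ^ n * 2]mulnC modnMDl addnC modn_small //.
by rewrite -muln2; case: (odd x); lia.
Qed.

Lemma bits_modn n x : bits n (x %% 2 ^ n) = bits n x.
Proof.
elim: n x => // n IH x; rewrite modn_exp2S /=.
by rewrite oddD odd_double oddb addFb addnC half_bit_double IH.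
Qed.

(** Fixed width means arithmetic modulo 2^n. This is why [exec_add] and [exec_mul] hold without
    bounds on the operands, while [exec_le] requires them. *)
Lemma bits_congr n x y : x = y %[mod 2 ^ n] -> bits n x = bits n y.
Proof. by move=> E; rewrite -(bits_modn n x) E bits_modn. Qed.

(** Reversal puts the most significant digit first, the order in which the Horner scheme of the
    multiplication consumes the digits. *)
Lemma rev_bits n x : exists l : seq bool, [/\ rev (bits n x) = map Some l,
  size l = n & forall b, foldl (fun a (k : bool) => a.*2 + k * b) 0 l = (x %% 2 ^ n) * b].
Proof.
elim: n x => [|n IH] x; first by exists [::]; split=> // b; rewrite modn1.
have [l [E1 E2 E3]] := IH x./2.
exists (rcons l (odd x)); rewrite /= rev_cons E1 map_rcons size_rcons E2.
by split=> // b; rewrite foldl_rcons E3 modn_exp2S mulnDl -!muln2 mulnAC.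
Qed.

(** * Arithmetic on numerals of width N^D *)

Section Macros.

Variables (N D : nat).
Let W := N ^ D.

(** Rounds on an empty stack do nothing, so [W] rounds serve every stack of at most [W] symbols. *)
Definition move1 a b := read a (fun x =>
  if x is Some y then Then (Pop a) (Push b y) else Skip).
Definition shift_prog a b := loops D (move1 a b).

Lemma iter_move1 n a b s : a <> b -> size (s a) <= n ->
  iter n (exec N (move1 a b)) s = upd (upd s a [::]) b (catrev (s a) (s b)).
Proof.
move=> ab; elim: n s => [|n IH] s H.
  have E : s a = [::] by case: (s a) H.
  by rewrite E; store_eq.
rewrite iterSr [exec N (move1 a b) s]exec_read; case E: (s a) H => [|x l] H /=.
  by rewrite IH E //; store_eq.
rewrite IH; last by reg_cases; rewrite E.
by store_eq; rewrite ?E.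
Qed.

Lemma exec_shift a b s : a <> b -> size (s a) <= W ->
  exec N (shift_prog a b) s = upd (upd s a [::]) b (catrev (s a) (s b)).
Proof. by move=> *; rewrite exec_loops iter_move1. Qed.

Definition copy1 t a b := read t (fun x =>
  if x is Some y then Then (Pop t) (Then (Push a y) (Push b y)) else Skip).
Definition copy_prog a b t := Then (shift_prog a t) (loops D (copy1 t a b)).

Lemma iter_copy1 n t a b (s : store) : uniq [:: a; b; t] -> size (s t) <= n ->
  iter n (exec N (copy1 t a b)) s =
  upd (upd (upd s t [::]) a (catrev (s t) (s a))) b (catrev (s t) (s b)).
Proof.
move=> U; split_uniq U; elim: n s => [|n IH] s H.
  have E : s t = [::] by case: (s t) H.
  by rewrite E; store_eq.
rewrite iterSr [exec N (copy1 t a b) s]exec_read; case E: (s t) H => [|x l] H /=.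
  by rewrite IH E //; store_eq.
rewrite IH; first by store_eq; rewrite ?E.
by reg_cases; rewrite E.
Qed.

Lemma exec_copy a b t (s : store) : uniq [:: a; b; t] -> size (s a) <= W ->
  s b = [::] -> s t = [::] -> exec N (copy_prog a b t) s = upd s b (s a).
Proof.
move=> U H Eb Et; rewrite /= exec_loops exec_shift //; last by split_uniq U.
rewrite iter_copy1 //; last by rewrite /upd eqxx Et size_catrev addn0.
split_uniq U; store_eq; rewrite ?Et ?Eb ?catrevE ?cats0 ?revK //.
Qed.

Definition zero_prog r := loops D (Push r (Some false)).

Lemma exec_zero r s : s r = [::] -> exec N (zero_prog r) s = upd s r (bits W 0).
Proof.
move=> E; rewrite exec_loops bits0 -/W; elim: W => [|n IH] /=.
  by store_eq.
by rewrite IH /= /upd eqxx; store_eq.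
Qed.

Definition clear_prog r := loops D (Pop r).

Lemma exec_clear r s : size (s r) <= W -> exec N (clear_prog r) s = upd s r [::].
Proof.
rewrite exec_loops -/W; elim: W s => [|n IH] s H.
  have E : s r = [::] by case: (s r) H.
  by store_eq.
rewrite iterSr IH /= /upd ?eqxx ?size_behead; first by store_eq.
by case: (s r) H.
Qed.

(** Setting the two lowest digits suffices: the only constants are 0, 1 and the codes of letters,
    all below 4. *)
Definition const_prog r v := Then (zero_prog r) (Then (Pop r) (Then (Pop r)
  (Then (Push r (Some (odd v./2))) (Push r (Some (odd v)))))).

Lemma exec_const r v s : 1 < W -> v < 4 -> s r = [::] ->
  exec N (const_prog r v) s = upd s r (bits W v).
Proof.
move=> HW Hv E; rewrite [LHS]/= exec_zero //.
case: W HW => [|[|n]] // _.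
have Ev : v./2./2 = 0 by case: v Hv => [|[|[|[|]]]].
by store_eq; rewrite /= Ev.
Qed.

(** The carry lives on top of [c], above whatever is there already. The digits of the sum pile up in
    [z] in reverse order, which the final shift to [x] undoes. *)
Definition add_step x y z c := read x (fun a => read y (fun b => read c (fun k =>
  let a := a == Some (Some true) in
  let b := b == Some (Some true) in
  let k := k == Some (Some true) in
  Then (Pop x) (Then (Pop y) (Then (Pop c)
    (Then (Push z (Some (a (+) b (+) k)))
          (Push c (Some ((a && b) || (k && (a || b))))))))))).
Definition add_prog x y z c := Then (Push c (Some false))
  (Then (loops D (add_step x y z c)) (Then (Pop c) (shift_prog z x))).

Lemma iter_add_step n x y z c (s : store) a b (k : bool) cs : uniq [:: x; y; z; c] ->
  s x = bits n a -> s y = bits n b -> s c = Some k :: cs ->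
  exists k' : bool, iter n (exec N (add_step x y z c)) s =
   upd (upd (upd (upd s x [::]) y [::]) z (catrev (bits n (a + b + k)) (s z)))
     c (Some k' :: cs).
Proof.
move=> U; split_uniq U; elim: n s a b k => [|n IH] s a b k Ex Ey Ec.
  by exists k; store_eq.
rewrite iterSr [exec N (add_step x y z c) s]exec_read !exec_read Ex Ey Ec.
have Eb d : (Some (Some d) == Some (Some true)) = d by case: d.
rewrite /= !Eb; set s1 := upd _ _ _.
set k1 := (odd a && odd b) || (k && (odd a || odd b)).
have [||| k' ->] := IH s1 a./2 b./2 k1.
- by rewrite /s1; reg_cases; rewrite Ex.
- by rewrite /s1; reg_cases; rewrite Ey.
- by rewrite /s1; reg_cases; rewrite Ec.
exists k'; have E1 : odd (a + b + k) = odd a (+) odd b (+) k.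
  by rewrite !oddD oddb.
have E2 : (a + b + k)./2 = a./2 + b./2 + k1.
  exact: half_sum.
by rewrite /s1; store_eq; rewrite /= E1 E2.
Qed.

Lemma exec_add x y z c (s : store) a b : uniq [:: x; y; z; c] ->
  s x = bits W a -> s y = bits W b -> s z = [::] ->
  exec N (add_prog x y z c) s = upd (upd s x (bits W (a + b))) y [::].
Proof.
move=> U Ex Ey Ez; rewrite [LHS]/= exec_loops.
have [||| k' ->] := @iter_add_step W x y z c (upd s c (Some false :: s c)) a b false (s c) U.
- by split_uniq U; reg_cases.
- by split_uniq U; reg_cases.
- by rewrite /upd eqxx.
split_uniq U.
rewrite exec_shift; [|lia|]; last first.
  reg_cases; rewrite ?size_catrev ?size_bits ?Ez //; try lia.
  by rewrite addn0.
by store_eq; rewrite ?Ez ?Ex ?addn0 ?catrevE ?cats0 ?revK //.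
Qed.

Definition le_step x y f := read x (fun a => read y (fun b => read f (fun k =>
  let a := a == Some (Some true) in
  let b := b == Some (Some true) in
  let k := k == Some (Some true) in
  Then (Pop x) (Then (Pop y) (Then (Pop f)
    (Push f (Some ((~~ a && b) || ((a == b) && k))))))))).
Definition le_prog x y f := Then (Push f (Some true))
  (Then (loops D (le_step x y f))
  (read f (fun k => Then (Pop f) (const_prog x (k == Some (Some true)))))).

Lemma iter_le_step n x y f (s : store) a b (k : bool) cs : uniq [:: x; y; f] ->
  a < 2 ^ n -> b < 2 ^ n ->
  s x = bits n a -> s y = bits n b -> s f = Some k :: cs ->
  iter n (exec N (le_step x y f)) s =
   upd (upd (upd s x [::]) y [::]) f (Some (a + ~~ k <= b) :: cs).
Proof.
move=> U; split_uniq U; elim: n s a b k => [|n IH] s a b k Ha Hb Ex Ey Ef.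
  have -> : a = 0 by lia.
  have -> : b = 0 by lia.
  by store_eq; rewrite /= Ef; case: (k).
rewrite iterSr [exec N (le_step x y f) s]exec_read !exec_read Ex Ey Ef.
have Eb d : (Some (Some d) == Some (Some true)) = d by case: d.
rewrite /= !Eb; set k1 := (_ || _); set s1 := upd _ _ _.
move: Ha Hb; rewrite expnS => Ha Hb.
rewrite (IH s1 a./2 b./2 k1); first last.
- by rewrite /s1; reg_cases; rewrite Ef.
- by rewrite /s1; reg_cases; rewrite Ey.
- by rewrite /s1; reg_cases; rewrite Ex.
- lia.
- lia.
have -> : (a./2 + ~~ k1 <= b./2) = (a + ~~ k <= b).
  exact: half_leq.
by rewrite /s1; store_eq.
Qed.

Lemma exec_le x y f (s : store) a b : 1 < W -> uniq [:: x; y; f] ->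
  a < 2 ^ W -> b < 2 ^ W -> s x = bits W a -> s y = bits W b ->
  exec N (le_prog x y f) s = upd (upd s x (bits W (a <= b))) y [::].
Proof.
move=> HW U Ha Hb Ex Ey; rewrite /le_prog !exec_then exec_loops.
rewrite (_ : exec N (Push f _) s = upd s f (Some true :: s f)) //.
rewrite (@iter_le_step W x y f _ a b true (s f)) //; first last.
- by rewrite /upd eqxx.
- by split_uniq U; reg_cases.
- by split_uniq U; reg_cases.
rewrite exec_read addn0 exec_then exec_const //; split_uniq U.
- by rewrite [exec N (Pop f) _]/=; store_eq; case: (a <= b).
- by case: (_ == _).
- by rewrite [exec N (Pop f) _]/=; reg_cases.
Qed.

(** One step of the Horner scheme: [x] is doubled by adding its own copy, then [y] is added if the
    next digit of the multiplier, held in [u], is 1. *)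
Definition mul_step x y u v t c :=
  Then (copy_prog x v t) (Then (add_prog x v t c) (read u (fun k => Then (Pop u)
    (if k == Some (Some true) then Then (copy_prog y v t) (add_prog x v t c) else Skip)))).
Definition mul_prog x y u v t c := Then (shift_prog x u) (Then (zero_prog x)
  (Then (loops D (mul_step x y u v t c)) (clear_prog y))).

Lemma exec_mul_step x y u v t c (s : store) a b (k : bool) l :
  uniq [:: x; y; u; v; t; c] -> s u = Some k :: l ->
  s x = bits W a -> s y = bits W b -> s v = [::] -> s t = [::] ->
  exec N (mul_step x y u v t c) s = upd (upd s x (bits W (a.*2 + k * b))) u l.
Proof.
move=> U Eu Ex Ey Ev Et; split_uniq U.
rewrite /mul_step exec_then.
rewrite exec_copy //; [|by uniq_tac|by rewrite Ex size_bits].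
set s1 := upd _ _ _.
have Hx : s1 x = bits W a by rewrite /s1; reg_cases.
have Hv : s1 v = bits W a by rewrite /s1; reg_cases.
have Ht : s1 t = [::] by rewrite /s1; reg_cases.
rewrite exec_then (exec_add _ Hx Hv Ht); last by uniq_tac.
set s2 := upd _ _ _.
have E2u : s2 u = Some k :: l by rewrite /s2 /s1; reg_cases.
rewrite exec_read E2u exec_then.
have -> : (ohead (Some k :: l) == Some (Some true)) = k by case: (k).
set s3 := exec _ (Pop u) _.
have E3 : s3 = upd (upd s x (bits W a.*2)) u l.
  rewrite /s3 /= E2u /s2 /s1 -addnn; store_eq.
case: (k); last first.
  by rewrite E3 mul0n addn0.
rewrite mul1n exec_then exec_copy.
- set s4 := upd _ _ _.
  rewrite (@exec_add x v t c s4 a.*2 b); first last.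
  + by rewrite /s4 E3; reg_cases.
  + by rewrite /s4 E3; reg_cases.
  + by rewrite /s4 E3; reg_cases.
  + by uniq_tac.
  by rewrite /s4 E3; store_eq.
- by uniq_tac.
- by rewrite E3; reg_cases; rewrite ?Ey ?size_bits.
- by rewrite E3; reg_cases.
- by rewrite E3; reg_cases.
Qed.

Lemma iter_mul_step x y u v t c (s : store) a b (l : seq bool) :
  uniq [:: x; y; u; v; t; c] -> s u = map Some l ->
  s x = bits W a -> s y = bits W b -> s v = [::] -> s t = [::] ->
  iter (size l) (exec N (mul_step x y u v t c)) s =
  upd (upd s x (bits W (foldl (fun a (k : bool) => a.*2 + k * b) a l))) u [::].
Proof.
move=> U; elim: l s a => [|k l IH] s a Eu Ex Ey Ev Et.
  by store_eq.
rewrite [size _]/= iterSr (@exec_mul_step _ _ _ _ _ _ _ a b k (map Some l)) //.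
have U' := U; split_uniq U'.
rewrite (IH _ (a.*2 + k * b)).
- by store_eq.
- by reg_cases.
- by reg_cases.
- by reg_cases.
- by reg_cases.
- by reg_cases.
Qed.

Lemma exec_mul x y u v t c (s : store) a b :
  uniq [:: x; y; u; v; t; c] -> s u = [::] ->
  s x = bits W a -> s y = bits W b -> s v = [::] -> s t = [::] ->
  exec N (mul_prog x y u v t c) s = upd (upd s x (bits W (a * b))) y [::].
Proof.
move=> U Eu Ex Ey Ev Et; have U' := U; split_uniq U'.
rewrite /mul_prog 3!exec_then exec_shift //; last by rewrite Ex size_bits.
rewrite exec_zero; last by reg_cases.
have [l [E1 E2 E3]] := rev_bits W a.
rewrite exec_loops -/W -[X in iter X (exec N (mul_step _ _ _ _ _ _))]E2.
rewrite (@iter_mul_step _ _ _ _ _ _ _ 0 b).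
- rewrite exec_clear; last first.
    by reg_cases; rewrite ?Ey ?size_bits.
  have EB : bits W (a %% 2 ^ W * b) = bits W (a * b).
    by apply: bits_congr; rewrite modnMml.
  by rewrite E3 EB; store_eq.
- by [].
- by reg_cases; rewrite // Ex Eu catrevE cats0.
- by reg_cases.
- by reg_cases.
- by reg_cases.
- by reg_cases.
Qed.

End Macros.

(** * Bounded terms and their compilation *)

Definition letter_code (x : option symbol) : nat :=
  match x with
  | None => 0
  | Some None => 1
  | Some (Some b) => b.+2
  end.

Inductive term :=
| Var of nat
| One
| Add of term & term
| Mul of term & term
| Le of term & term
| Big of bool & term.

Definition letter (w : seq symbol) (p : nat) : nat := letter_code (ohead (drop p w)).

(* [Big] binds the round number and the code of the letter at that position. *)
Fixpoint eval (w : seq symbol) (t : term) (rho : seq nat) : nat :=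
  match t with
  | Var i => nth 0 rho i
  | One => 1
  | Add a b => eval w a rho + eval w b rho
  | Mul a b => eval w a rho * eval w b rho
  | Le a b => eval w a rho <= eval w b rho
  | Big false a => \sum_(0 <= i < (size w).+2) eval w a (letter w i :: i :: rho)
  | Big true a => \prod_(0 <= i < (size w).+2) eval w a (letter w i :: i :: rho)
  end.

Fixpoint rank (t : term) : nat :=
  match t with
  | Add a b | Mul a b | Le a b => (maxn (rank a) (rank b)).+1
  | Big _ a => (rank a).+1
  | _ => 1
  end.

Definition op_prog D (p : bool) x b :=
  if p then mul_prog D x b b.+1 b.+2 b.+3 b.+4 else add_prog D x b b.+1 b.+2.

(** Layout: [r] accumulates, [r.+1] is the round number, [r.+2] the code of the current letter,
    [r.+3] the unread suffix of the word and [r.+4] the value of the body. Past the end of the word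
    the suffix is empty, which reads as the letter code 0. *)
Definition big_body D (p : bool) (ct : prog) r :=
  Then (read r.+3 (fun x => Then (const_prog D r.+2 (letter_code x)) (Pop r.+3)))
  (Then ct
  (Then (op_prog D p r r.+4)
  (Then (clear_prog D r.+2)
  (Then (const_prog D r.+4 1) (add_prog D r.+1 r.+4 r.+4.+1 r.+4.+2))))).

(* The value goes to register [r]; all registers from [r] on are free, and
   the variable [i] is in the register [nth 0 vs i]. *)
Fixpoint compile_term (D : nat) (t : term) (vs : seq nat) (r : nat) : prog :=
  match t with
  | Var i => if i < size vs then copy_prog D (nth 0 vs i) r r.+1 else const_prog D r 0
  | One => const_prog D r 1
  | Add a b => Then (compile_term D a vs r) (Then (compile_term D b vs r.+1)
                 (add_prog D r r.+1 r.+2 r.+3))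
  | Mul a b => Then (compile_term D a vs r) (Then (compile_term D b vs r.+1)
                 (mul_prog D r r.+1 r.+2 r.+3 r.+4 r.+4.+1))
  | Le a b => Then (compile_term D a vs r) (Then (compile_term D b vs r.+1)
                 (le_prog D r r.+1 r.+2))
  | Big p a => Then (const_prog D r p) (Then (const_prog D r.+1 0)
      (Then (copy_prog D 0 r.+3 r.+4)
      (Then (Loop (big_body D p (compile_term D a (r.+2 :: r.+1 :: vs) r.+4) r))
        (clear_prog D r.+1))))
  end.

Lemma rank_gt0 t : 0 < rank t.
Proof. by case: t. Qed.

Lemma letter_lt w p : letter w p < 4.
Proof. by rewrite /letter; case: (ohead _) => [[[]|]|]. Qed.

Lemma prod_ltn_exp (n M : nat) (F : nat -> nat) : (forall i, i < n -> F i < M) -> 0 < n ->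
  \prod_(0 <= i < n) F i < M ^ n.
Proof.
case: M => [|M] H n0; first by have := H 0 n0.
apply: (@leq_ltn_trans (M ^ n)); last by rewrite ltn_exp2r.
rewrite big_mkord; apply: (@leq_trans (\prod_(i < n) M)); last first.
  by rewrite prod_nat_const card_ord.
by apply: leq_prod => i _; rewrite -ltnS; exact: H.
Qed.

Lemma sum_leq_mul (n M : nat) (F : nat -> nat) : (forall i, i < n -> F i <= M) ->
  \sum_(0 <= i < n) F i <= n * M.
Proof.
move=> H; rewrite big_mkord; apply: (@leq_trans (\sum_(i < n) M)).
  by apply: leq_sum => i _; exact: H.
by rewrite sum_nat_const card_ord.
Qed.

(** Each constructor raises the exponent of N by at most one. With M = 2^(N^d), two operands below M
    give results below M^2 <= 2^(N^(d+1)), a product of N factors stays below M^N = 2^(N^(d+1)), and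
    a sum of N terms below N M <= M^2. *)
Lemma eval_lt w t rho : all (fun x => x < 2 ^ (size w).+2) rho ->
  eval w t rho < 2 ^ ((size w).+2 ^ rank t).
Proof.
set N := (size w).+2; have N2 : 1 < N by [].
have HN : N < 2 ^ N by exact: ltn_expl.
have mono a b d : a < 2 ^ (N ^ d) -> d <= b -> a < 2 ^ (N ^ b).
  by move=> Ha Hd; apply: leq_trans Ha _; rewrite leq_exp2l // leq_pexp2l.
have up d : 2 ^ (N ^ d) * 2 ^ (N ^ d) <= 2 ^ (N ^ d.+1).
  by rewrite -expnD leq_exp2l // addnn -mul2n expnS leq_mul2r N2 orbT.
have big2 d : 1 < 2 ^ (N ^ d) by rewrite -{1}(expn0 2) ltn_exp2l ?expn_gt0.
elim: t rho => [i||a IHa b IHb|a IHa b IHb|a IHa b IHb|p a IHa] rho Hr.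
- rewrite /= expn1; case: (ltnP i (size rho)) => Hi; last by rewrite nth_default ?expn_gt0.
  exact: (allP Hr) (mem_nth 0 Hi).
- by rewrite /= big2.
- have Ha := mono _ _ _ (IHa _ Hr) (leq_maxl (rank a) (rank b)).
  have Hb := mono _ _ _ (IHb _ Hr) (leq_maxr (rank a) (rank b)).
  apply: leq_trans (up _); have := big2 (maxn (rank a) (rank b)).
  move=> M1; apply: leq_trans (leq_add Ha (ltnW Hb)) _.
  by rewrite addnn -muln2 leq_mul2l M1 orbT.
- have Ha := mono _ _ _ (IHa _ Hr) (leq_maxl (rank a) (rank b)).
  have Hb := mono _ _ _ (IHb _ Hr) (leq_maxr (rank a) (rank b)).
  by apply: leq_trans (up _); rewrite [eval _ _ _]/= ltn_mul.
- by apply: leq_ltn_trans (leq_b1 _) (big2 _).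
have Hi i : i < N -> all (fun x => x < 2 ^ N) [:: letter w i, i & rho].
  move=> Hi /=; rewrite Hr (ltn_trans Hi HN) !andbT.
  by apply: (leq_trans (letter_lt w i)); rewrite -[4]/(2 ^ 2) leq_exp2l.
have IH i : i < N -> eval w a [:: letter w i, i & rho] < 2 ^ (N ^ rank a).
  by move=> /Hi; exact: IHa.
case: p => /=; rewrite -/N.
  apply: leq_trans (prod_ltn_exp IH _) _ => //.
  by rewrite -expnM expnS mulnC.
apply: (@leq_ltn_trans (N * (2 ^ (N ^ rank a)).-1)).
  by apply: sum_leq_mul => i /IH; case: (2 ^ _).
apply: leq_trans (up _).
apply: (@leq_trans (N * 2 ^ (N ^ rank a))).
  by rewrite ltn_mul2l /= ltn_predL expn_gt0.
rewrite leq_mul2r; apply/orP; right; apply: (leq_trans (ltnW HN)).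
by rewrite leq_exp2l // -{1}(expn1 N) leq_pexp2l // rank_gt0.
Qed.

Section Comp.

Variables (w : seq symbol) (D : nat).
Hypothesis D0 : 0 < D.
Let N := (size w).+2.
Let W := N ^ D.

Definition compile_term_ok t := forall vs rho r (s : store), rank t <= D ->
  size vs = size rho -> all (fun x => x < 2 ^ N) rho -> 0 < r -> s 0 = w ->
  (forall i, i < size vs ->
     nth 0 vs i < r /\ s (nth 0 vs i) = bits W (nth 0 rho i)) ->
  (forall j, r <= j -> s j = [::]) ->
  exec N (compile_term D t vs r) s = upd s r (bits W (eval w t rho)).

Let W1 : 1 < W.
Proof. by rewrite -(exp1n D) ltn_exp2r. Qed.

Let size_w : size w <= W.
Proof.
by apply: (@leq_trans N); [exact: ltnW | rewrite -{1}(expn1 N) leq_pexp2l].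
Qed.

Lemma exec_op (p : bool) x b (s : store) a c : x < b -> (forall j, b < j -> s j = [::]) ->
  s x = bits W a -> s b = bits W c ->
  exec N (op_prog D p x b) s =
  upd (upd s x (bits W (if p then a * c else a + c))) b [::].
Proof.
move=> xb Hs Hx Hb; rewrite /op_prog; case: p.
  by rewrite (exec_mul _ _ Hx Hb) ?Hs //; uniq_tac.
by rewrite (exec_add _ Hx Hb) ?Hs //; uniq_tac.
Qed.

Definition big_acc (p : bool) t rho i : nat :=
  if p then \prod_(0 <= k < i) eval w t (letter w k :: k :: rho)
  else \sum_(0 <= k < i) eval w t (letter w k :: k :: rho).

Lemma big_bodyP (p : bool) t vs rho r (s : store) i : compile_term_ok t ->
  rank t <= D -> i < N ->
  size vs = size rho -> all (fun x => x < 2 ^ N) rho -> 0 < r -> s 0 = w ->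
  (forall i, i < size vs ->
     nth 0 vs i < r /\ s (nth 0 vs i) = bits W (nth 0 rho i)) ->
  (forall j, r <= j -> s j = [::]) ->
  exec N (big_body D p (compile_term D t (r.+2 :: r.+1 :: vs) r.+4) r)
    (upd (upd (upd s r (bits W (big_acc p t rho i))) r.+1 (bits W i))
      r.+3 (drop i w)) =
  upd (upd (upd s r (bits W (big_acc p t rho i.+1))) r.+1 (bits W i.+1))
      r.+3 (drop i.+1 w).
Proof.
move=> IH Ht Hi Hvs Hrho r0 Hw Hv Hs.
rewrite /big_body 4!exec_then exec_read.
rewrite [exec N (Then (const_prog _ _ _) (Pop _)) _]exec_then.
set s1 := upd _ _ (drop i w).
have E3 : s1 r.+3 = drop i w by rewrite /s1; reg_cases.
rewrite E3 -/(letter w i) exec_const ?letter_lt //; last by rewrite /s1; reg_cases; apply: Hs; lia.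
set s2 := exec _ (Pop _) _.
have E2 : s2 = upd (upd (upd (upd s r (bits W (big_acc p t rho i)))
    r.+1 (bits W i)) r.+3 (drop i.+1 w)) r.+2 (bits W (letter w i)).
  rewrite /s2 /= (_ : upd _ _ _ r.+3 = drop i w); last first.
    by rewrite /s1; reg_cases.
  rewrite -drop1 drop_drop add1n /s1; store_eq.
rewrite (IH _ [:: letter w i, i & rho]) //; first last.
- by move=> j Hj; rewrite E2; reg_cases; apply: Hs; lia.
- case=> [|[|k]] Hk /=.
  + by split; rewrite // E2; reg_cases.
  + by split; [lia | rewrite E2; reg_cases].
  + have [Hr Hb] := Hv k Hk; split; first lia.
    by rewrite -Hb E2; reg_cases.
- by rewrite E2; reg_cases.
- apply/and3P; split=> //.
  + by apply: (leq_trans (letter_lt w i)); rewrite -[4]/(2 ^ 2) leq_exp2l.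
  + by apply: (ltn_trans Hi); exact: ltn_expl.
- by rewrite /= Hvs.
set v := eval _ _ _; set s3 := upd s2 _ _.
rewrite (@exec_op p r r.+4 s3 (big_acc p t rho i) v); first last.
- by rewrite /s3 /upd eqxx.
- by rewrite /s3 E2; reg_cases.
- by move=> j Hj; rewrite /s3 E2; reg_cases; apply: Hs; lia.
- lia.
have -> : (if p then big_acc p t rho i * v else big_acc p t rho i + v) =
    big_acc p t rho i.+1.
  by rewrite /big_acc; case: (p); rewrite big_nat_recr.
rewrite exec_clear; last by rewrite /s3 E2; reg_cases; rewrite size_bits.
rewrite exec_then exec_const //; last by reg_cases.
rewrite (@exec_add _ _ _ _ _ _ _ i 1).
- rewrite addn1 /s3 E2; store_eq; apply/esym/Hs; lia.
- by uniq_tac.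
- by rewrite /s3 E2; reg_cases.
- by rewrite /upd eqxx.
- by rewrite /s3 E2; reg_cases; apply: Hs; lia.
Qed.

Lemma exec_compile_term t : compile_term_ok t.
Proof.
elim: t => [i||a IHa b IHb|a IHa b IHb|a IHa b IHb|p a IHa] vs rho r s HD Hvs Hrho r0 Hw Hv Hs.
- rewrite /=; case: ifP => Hi.
    have [Hr Hb] := Hv i Hi.
    rewrite exec_copy ?Hb ?size_bits ?Hs //; uniq_tac.
  by rewrite exec_const ?Hs // nth_default // -Hvs leqNgt Hi.
- by rewrite exec_const ?Hs.
all: try (move: (HD); rewrite [rank _]/= gtn_max => /andP[Da Db];
  have := ltnW Da; have := ltnW Db => {}Db {}Da;
  rewrite [compile_term _ _ _ _]/= 2!exec_then (IHa _ rho) //;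
  rewrite (IHb _ rho) //; first last).
- by move=> j Hj; reg_cases; apply: Hs; lia.
- by move=> i Hi; have [Hr Hb] := Hv i Hi; split; [lia | rewrite -Hb; reg_cases].
- by reg_cases.
- rewrite (@exec_add _ _ _ _ _ _ _ (eval w a rho) (eval w b rho)).
  + by store_eq; apply/esym/Hs; lia.
  + by uniq_tac.
  + by reg_cases.
  + by reg_cases.
  + by reg_cases; apply: Hs; lia.
- by move=> j Hj; reg_cases; apply: Hs; lia.
- by move=> i Hi; have [Hr Hb] := Hv i Hi; split; [lia | rewrite -Hb; reg_cases].
- by reg_cases.
- rewrite (@exec_mul _ _ _ _ _ _ _ _ _ (eval w a rho) (eval w b rho)).
  + by store_eq; apply/esym/Hs; lia.
  + by uniq_tac.
  + by reg_cases; apply: Hs; lia.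
  + by reg_cases.
  + by reg_cases.
  + by reg_cases; apply: Hs; lia.
  + by reg_cases; apply: Hs; lia.
- by move=> j Hj; reg_cases; apply: Hs; lia.
- by move=> i Hi; have [Hr Hb] := Hv i Hi; split; [lia | rewrite -Hb; reg_cases].
- by reg_cases.
- have lt t : rank t <= D -> eval w t rho < 2 ^ W.
    move=> Ht; apply: (leq_trans (eval_lt t Hrho)).
    by rewrite leq_exp2l // leq_pexp2l.
  rewrite (@exec_le _ _ _ _ _ _ (eval w a rho) (eval w b rho)) ?lt //.
  + by store_eq; apply/esym/Hs; lia.
  + by uniq_tac.
  + by reg_cases.
  + by reg_cases.
rewrite [compile_term _ _ _ _]/= 4!exec_then [exec N (const_prog D r p) s]exec_const; [|by []|by case: (p)|exact: Hs].
rewrite exec_const //; last by reg_cases; apply: Hs; lia.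
rewrite exec_copy; first last.
- by reg_cases; apply: Hs; lia.
- by reg_cases; apply: Hs; lia.
- by reg_cases; rewrite Hw.
- by uniq_tac.
rewrite (_ : upd _ _ _ 0 = w); last by reg_cases.
set s1 := upd _ _ _; set body := big_body _ _ _ _.
have inv i : i <= N -> iter i (exec N body) s1 =
  upd (upd (upd s r (bits W (big_acc p a rho i))) r.+1 (bits W i)) r.+3 (drop i w).
  elim: i => [_|i IH Hi].
    by rewrite /s1 drop0 /big_acc !big_nil [iter _ _ _]/=; case: (p).
  rewrite iterS IH ?(ltnW Hi) //; apply: big_bodyP => //.
  by apply: ltnW; move: HD.
rewrite -[exec N (Loop _) s1]/(iter N (exec N body) s1) inv // exec_clear; last first.
  by reg_cases; rewrite ?size_bits.
have -> : eval w (Big p a) rho = big_acc p a rho N by rewrite /=; case: (p).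
rewrite drop_oversize; last by rewrite /N; lia.
by store_eq; apply/esym/Hs; lia.
Qed.

End Comp.

Theorem term_polytime (t : term) (L : seq symbol -> Prop) :
  (forall w, eval w t [::] <= 1) -> (forall w, eval w t [::] = 1 <-> L w) ->
  polytime_decidable L.
Proof.
move=> H1 HL; pose D := rank t.
apply: (@prog_polytime (compile_term D t [::] 1) 1) => w; rewrite -HL.
have D0 : 0 < D by exact: rank_gt0.
rewrite (@exec_compile_term w D D0 t [::] [::] 1) //; last by case.
rewrite /upd eqxx; case E: (_ ^ D) => [|n]; first by move: E; lia.
(* The lowest digit is on top of the stack, and for a value of at most 1 it is the answer. *)
have := H1 w; case: (eval _ _ _) => [|[]] //= _.
Qed.

(** * Lobbying as a bounded arithmetical formula *)

(** Lets the formula be written as an ordinary Rocq function of the word and the environment; the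
    term behind it is assembled by the closure lemmas below. Variables outside the list read as
    0. *)
Definition definable (f : seq symbol -> (nat -> nat) -> nat) : Prop :=
  exists t, forall w l, eval w t l = f w (nth 0 l).

Fixpoint ren (xi : nat -> nat) (t : term) : term :=
  match t with
  | Var i => Var (xi i)
  | One => One
  | Add a b => Add (ren xi a) (ren xi b)
  | Mul a b => Mul (ren xi a) (ren xi b)
  | Le a b => Le (ren xi a) (ren xi b)
  | Big p a => Big p (ren (fun i => if i is j.+2 then (xi j).+2 else i) a)
  end.

Lemma eval_ren w t xi l l' : (forall i, nth 0 l (xi i) = nth 0 l' i) ->
  eval w (ren xi t) l = eval w t l'.
Proof.
elim: t xi l l' => [i||a IHa b IHb|a IHa b IHb|a IHa b IHb|p a IHa] xi l l' H //=;
  try by rewrite (IHa _ _ _ H) (IHb _ _ _ H).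
case: p; apply: eq_big_nat => i _; apply: IHa; by case=> [|[|j]] /=.
Qed.

(** Two places, because [Big] binds two variables: the letter as variable 0 and the round number as
    variable 1. *)
Definition shift2 (rho : nat -> nat) : nat -> nat := fun i => rho i.+2.

Lemma def_shift f : definable f -> definable (fun w rho => f w (shift2 rho)).
Proof.
case=> t Ht; exists (ren (fun i => i.+2) t) => w l.
rewrite (eval_ren w t (l' := drop 2 l)); last by move=> i; rewrite nth_drop.
rewrite Ht; congr f; apply: functional_extensionality => i; exact: nth_drop.
Qed.

Lemma def_var i : definable (fun _ rho => rho i).
Proof. by exists (Var i). Qed.

Lemma def_add f g : definable f -> definable g ->
  definable (fun w rho => f w rho + g w rho).
Proof. by case=> [t Ht] [u Hu]; exists (Add t u) => w l /=; rewrite Ht Hu. Qed.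

Lemma def_mul f g : definable f -> definable g ->
  definable (fun w rho => f w rho * g w rho).
Proof. by case=> [t Ht] [u Hu]; exists (Mul t u) => w l /=; rewrite Ht Hu. Qed.

Lemma def_le f g : definable f -> definable g ->
  definable (fun w rho => nat_of_bool (f w rho <= g w rho)).
Proof. by case=> [t Ht] [u Hu]; exists (Le t u) => w l /=; rewrite Ht Hu. Qed.

Lemma def_ext f g : (forall w rho, f w rho = g w rho) -> definable f -> definable g.
Proof. by move=> E [t Ht]; exists t => w l; rewrite Ht. Qed.

Lemma def_const n : definable (fun _ _ => n).
Proof.
elim: n => [|n IH].
  (* Zero is the value of the false comparison 2 <= 1. *)
  by exists (Le (Add One One) One).
have H1 : definable (fun _ _ => 1) by exists One.
by apply: def_ext (def_add H1 IH) => w rho; rewrite add1n.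
Qed.

Lemma def_succ f : definable f -> definable (fun w rho => (f w rho).+1).
Proof. by move=> H; apply: def_ext (def_add (def_const 1) H). Qed.

Lemma def_sum (F : seq symbol -> (nat -> nat) -> nat -> nat) :
  definable (fun w rho => F w (shift2 rho) (rho 1)) ->
  definable (fun w rho => \sum_(0 <= i < (size w).+2) F w rho i).
Proof. by case=> t Ht; exists (Big false t) => w l /=; apply: eq_bigr => i _; rewrite Ht. Qed.

Lemma def_prod (F : seq symbol -> (nat -> nat) -> nat -> nat) :
  definable (fun w rho => F w (shift2 rho) (rho 1)) ->
  definable (fun w rho => \prod_(0 <= i < (size w).+2) F w rho i).
Proof. by case=> t Ht; exists (Big true t) => w l /=; apply: eq_bigr => i _; rewrite Ht. Qed.

Lemma def_not (P : seq symbol -> (nat -> nat) -> bool) :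
  definable (fun w rho => nat_of_bool (P w rho)) ->
  definable (fun w rho => nat_of_bool (~~ P w rho)).
Proof.
by move=> H; apply: def_ext (def_le H (def_const 0)) => w rho; case: (P _ _).
Qed.

Lemma def_and (P P' : seq symbol -> (nat -> nat) -> bool) :
  definable (fun w rho => nat_of_bool (P w rho)) ->
  definable (fun w rho => nat_of_bool (P' w rho)) ->
  definable (fun w rho => nat_of_bool (P w rho && P' w rho)).
Proof.
by move=> H H'; apply: def_ext (def_mul H H') => w rho; case: (P _ _); case: (P' _ _).
Qed.

Lemma def_or (P P' : seq symbol -> (nat -> nat) -> bool) :
  definable (fun w rho => nat_of_bool (P w rho)) ->
  definable (fun w rho => nat_of_bool (P' w rho)) ->
  definable (fun w rho => nat_of_bool (P w rho || P' w rho)).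
Proof.
move=> H H'; apply: def_ext (def_not (def_and (def_not H) (def_not H'))) => w rho.
by rewrite negb_and !negbK.
Qed.

Lemma def_imp (P P' : seq symbol -> (nat -> nat) -> bool) :
  definable (fun w rho => nat_of_bool (P w rho)) ->
  definable (fun w rho => nat_of_bool (P' w rho)) ->
  definable (fun w rho => nat_of_bool (P w rho ==> P' w rho)).
Proof.
by move=> H H'; apply: def_ext (def_or (def_not H) H') => w rho; rewrite implybE.
Qed.

Lemma def_eq f g : definable f -> definable g ->
  definable (fun w rho => nat_of_bool (f w rho == g w rho)).
Proof.
move=> H H'; apply: def_ext (def_and (def_le H H') (def_le H' H)) => w rho.
by rewrite -eqn_leq.
Qed.

Lemma def_if P f g :
  definable (fun w rho => nat_of_bool (P w rho)) -> definable f -> definable g ->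
  definable (fun w rho => if P w rho then f w rho else g w rho).
Proof.
move=> H Hf Hg.
apply: def_ext (def_add (def_mul H Hf) (def_mul (def_not H) Hg)) => w rho.
by case: (P _ _); rewrite /= !(mul1n, mul0n) ?addn0.
Qed.

Lemma def_ifb (P P1 P2 : seq symbol -> (nat -> nat) -> bool) :
  definable (fun w rho => nat_of_bool (P w rho)) ->
  definable (fun w rho => nat_of_bool (P1 w rho)) ->
  definable (fun w rho => nat_of_bool (P2 w rho)) ->
  definable (fun w rho => nat_of_bool (if P w rho then P1 w rho else P2 w rho)).
Proof.
by move=> H H1 H2; apply: def_ext (def_if H H1 H2) => w rho; case: (P _ _).
Qed.

Definition forall_below (w : seq symbol) (P : pred nat) := all P (iota 0 (size w).+2).

Lemma forall_belowP w (P : pred nat) : reflect (forall i, i < (size w).+2 -> P i) (forall_below w P).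
Proof.
by apply: (iffP allP) => H i; have := H i; rewrite mem_iota.
Qed.

Lemma def_forall_below (P : seq symbol -> (nat -> nat) -> nat -> bool) :
  definable (fun w rho => nat_of_bool (P w (shift2 rho) (rho 1))) ->
  definable (fun w rho => nat_of_bool (forall_below w (P w rho))).
Proof.
move/(@def_prod (fun w rho i => nat_of_bool (P w rho i))); apply: def_ext => w rho.
rewrite /forall_below /index_iota subn0; elim: (iota _ _) => [|a l IH] /=; first by rewrite big_nil.
by rewrite big_cons IH; case: (P _ _ _); case: (all _ _).
Qed.

(** A term sees only the letter at the current round number, so the letter at a computed position is
    a sum over all rounds in which one summand survives. Positions that no round reaches lie beyond
    the word, where the letter code is 0 like the empty sum. *)
Lemma def_letter f : definable f -> definable (fun w rho => letter w (f w rho)).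
Proof.
move=> /def_shift H.
have [t Ht] := def_mul (def_eq (def_var 1) H) (def_var 0).
exists (Big false t) => w l /=; under eq_big_nat => i _ do rewrite Ht /=.
case: (ltnP (f w (nth 0 l)) (size w).+2) => Hn.
  rewrite (bigD1_seq (f w (nth 0 l))) ?iota_uniq ?mem_index_iota //= eqxx mul1n.
  by rewrite big1 ?addn0 // => i /negbTE ->.
rewrite big_nat big1 => [|i Hi].
  by rewrite /letter drop_oversize //; lia.
by rewrite ltn_eqF // (leq_trans _ Hn).
Qed.

(* [def_macro] is extended, by [::=], whenever a function has been shown to be
   definable. *)
Ltac def_macro := fail.
Ltac def_leaf H := first
  [ exact: H | exact: (def_shift H) | exact: (def_shift (def_shift H))
  | exact: (def_shift (def_shift (def_shift H))) ].
Ltac def_step := match goal with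
  | H : definable ?f |- definable (fun w rho => ?f w _) => def_leaf H
  | |- _ => lazymatch goal with
    | |- definable (fun _ _ => ?c) => exact: (def_const c)
    | |- definable (fun w rho => rho _) => exact: def_var
    | |- definable (fun w rho => shift2 _ _) => exact: def_var
    | |- definable (fun w rho => S (@?f w rho)) => apply: (@def_succ f)
    | |- definable (fun w rho => addn (@?f w rho) (@?g w rho)) => apply: (@def_add f g)
    | |- definable (fun w rho => muln (@?f w rho) (@?g w rho)) => apply: (@def_mul f g)
    | |- definable (fun w rho => nat_of_bool (andb (@?f w rho) (@?g w rho))) =>
        apply: (@def_and f g)
    | |- definable (fun w rho => nat_of_bool (orb (@?f w rho) (@?g w rho))) =>
        apply: (@def_or f g)
    | |- definable (fun w rho => nat_of_bool (implb (@?f w rho) (@?g w rho))) =>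
        apply: (@def_imp f g)
    | |- definable (fun w rho => nat_of_bool (negb (@?f w rho))) => apply: (@def_not f)
    | |- definable (fun w rho => nat_of_bool (leq (@?f w rho) (@?g w rho))) =>
        apply: (@def_le f g)
    | |- definable (fun w rho => nat_of_bool (eq_op (@?f w rho) (@?g w rho))) =>
        apply: (@def_eq f g)
    | |- definable (fun w rho => nat_of_bool (forall_below w (@?P w rho))) =>
        apply: (@def_forall_below P)
    | |- definable (fun w rho => bigop 0 _ _) => apply: def_sum
    | |- definable (fun w rho => bigop 1 _ _) => apply: def_prod
    | |- definable (fun w rho => letter w (@?f w rho)) => apply: (@def_letter f)
    | |- _ => first [def_macro | apply: def_ifb]
    end end.
Ltac solve_definable := repeat (cbv beta; def_step).

(** * The formula: parsing the word, winning an issue, total cost *)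

Definition separators w p := \sum_(0 <= i < (size w).+2) ((i < p) && (letter w i == 1)).
(** The positions with fewer than [q] separators before them are those of the first [q] tokens, so
    their number is the position at which token [q] starts. *)
Definition token_start w q := \sum_(0 <= p < (size w).+2) ((letter w p != 0) && (separators w p < q)).
(** Terms have no exponentiation; as a bounded product this is 2^l for [l] up to |w| + 2, enough for
    the digits of a token. *)
Definition pow2 (w : seq symbol) l := \prod_(0 <= i < (size w).+2) (1 + (i < l)).
(** The successor leaves out the separator that ends the token. *)
Definition in_token w q l := (token_start w q + l).+1 < token_start w q.+1.
Definition token_bit w q l := letter w (token_start w q + l) == 3.
Definition numeral w q lo := \sum_(0 <= l < (size w).+2)
  (in_token w q (lo + l) && token_bit w q (lo + l)) * pow2 w l.
Definition canonical_from w q lo := forall_below w (fun l =>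
  in_token w q (lo + l) && ~~ in_token w q (lo + l).+1 ==> token_bit w q (lo + l)).

Lemma def_separators f : definable f ->
  definable (fun w rho => separators w (f w rho)).
Proof. by move=> H; rewrite /separators; solve_definable. Qed.

Ltac def_macro1 := lazymatch goal with
  | |- definable (fun w rho => separators w (@?f w rho)) =>
      apply: (@def_separators f)
  end.
Ltac def_macro ::= def_macro1.

Lemma def_token_start f : definable f ->
  definable (fun w rho => token_start w (f w rho)).
Proof. by move=> H; rewrite /token_start; solve_definable. Qed.

Lemma def_pow2 f : definable f -> definable (fun w rho => pow2 w (f w rho)).
Proof. by move=> H; rewrite /pow2; solve_definable. Qed.

Ltac def_macro2 := lazymatch goal with
  | |- definable (fun w rho => token_start w (@?f w rho)) =>
      apply: (@def_token_start f)
  | |- definable (fun w rho => pow2 w (@?f w rho)) => apply: (@def_pow2 f)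
  | |- _ => def_macro1
  end.
Ltac def_macro ::= def_macro2.

Lemma def_in_token f g : definable f -> definable g ->
  definable (fun w rho => nat_of_bool (in_token w (f w rho) (g w rho))).
Proof. by move=> Hf Hg; rewrite /in_token; solve_definable. Qed.

Lemma def_token_bit f g : definable f -> definable g ->
  definable (fun w rho => nat_of_bool (token_bit w (f w rho) (g w rho))).
Proof. by move=> Hf Hg; rewrite /token_bit; solve_definable. Qed.

Ltac def_macro3 := lazymatch goal with
  | |- definable (fun w rho => nat_of_bool (in_token w (@?f w rho) (@?g w rho))) =>
      apply: (@def_in_token f g)
  | |- definable (fun w rho => nat_of_bool (token_bit w (@?f w rho) (@?g w rho))) =>
      apply: (@def_token_bit f g)
  | |- _ => def_macro2
  end.
Ltac def_macro ::= def_macro3.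

Lemma def_numeral f g : definable f -> definable g ->
  definable (fun w rho => numeral w (f w rho) (g w rho)).
Proof. by move=> Hf Hg; rewrite /numeral; solve_definable. Qed.

Lemma def_canonical_from f g : definable f -> definable g ->
  definable (fun w rho => nat_of_bool (canonical_from w (f w rho) (g w rho))).
Proof. by move=> Hf Hg; rewrite /canonical_from; solve_definable. Qed.

Definition num_tokens w := \sum_(0 <= p < (size w).+2) (letter w p == 1).
Definition code_voters w := numeral w 0 0.
Definition code_issues w := numeral w 1 0.
Definition code_level1 w := (numeral w 2 0).+1.
(* The index of the token made of the target, the sign and the budget. *)
Definition code_tail w := 3 + (2 * (code_voters w * code_issues w) +
  code_voters w * code_issues w * (code_level1 w).+1).
Definition code_num w i j := numeral w (3 + 2 * (i * code_issues w + j)) 0.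
Definition code_den w i j := numeral w (4 + 2 * (i * code_issues w + j)) 0.
Definition code_price w i j a :=
  numeral w (3 + 2 * (code_voters w * code_issues w) + ((i * code_issues w + j) * (code_level1 w).+1 + a)) 0.
Definition code_target w j := token_bit w (code_tail w) j.
Definition code_budget w := numeral w (code_tail w) (code_issues w).+1.
Definition code_tnum w := numeral w (code_tail w).+1 0.
Definition code_tden w := numeral w (code_tail w).+2 0.
(* The numerator of [prob i j] over the denominator [level + 1]. *)
Definition code_grid w i j :=
  \sum_(0 <= y < (size w).+2) (y.+1 * code_den w i j <= code_num w i j * code_level1 w).

(** A nonempty word must end with a separator. Nothing more is needed to cut it into tokens, see
    [enc_surj]. *)
Definition words_ok w := forall_below w (fun p =>
  (letter w p != 0) && (letter w p.+1 == 0) ==> (letter w p == 1)).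

Definition entry_ok w i j :=
  [&& 0 < code_den w i j, code_num w i j <= code_den w i j,
      code_grid w i j * code_den w i j == code_num w i j * code_level1 w,
      code_price w i j (code_grid w i j) == 0 &
      forall_below w (fun a => forall_below w (fun b => (a <= code_level1 w) && (b <= code_level1 w) ==>
        ((code_grid w i j <= a) && (a <= b)) || ((b <= a) && (a <= code_grid w i j)) ==>
        (code_price w i j a <= code_price w i j b)))].

(* A negative budget is rejected here, as it makes a no-instance anyway. *)
Definition format_ok w :=
  [&& words_ok w, num_tokens w == 3 + code_tail w,
      forall_below w (fun q => (q < num_tokens w) && (q != code_tail w) ==>
        canonical_from w q 0),
      in_token w (code_tail w) (code_issues w),
      ~~ token_bit w (code_tail w) (code_issues w),
      canonical_from w (code_tail w) (code_issues w).+1, 0 < code_voters w,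
      0 < code_tden w, code_tnum w <= code_tden w &
      forall_below w (fun i => forall_below w (fun j =>
        (i < code_voters w) && (j < code_issues w) ==> entry_ok w i j))].

(* [code_support w i j c / (level + 1)] is the probability that voter [i], having received [c],
   votes on issue [j] as the Lobby wants. *)
Definition code_support w i j c := \sum_(0 <= y < (size w).+2) ((y < code_level1 w) &&
  (if code_target w j then (y < code_grid w i j) || (code_price w i j y.+1 <= c)
   else (code_grid w i j <= y) || (code_price w i j y <= c))).

(** The winning criteria with denominators cleared, [c] being the amount that each single voter
    receives. *)
Definition wins Y w j c :=
  match Y with
  | StrictMajority => code_voters w < 2 * \sum_(0 <= i < (size w).+2)
      ((i < code_voters w) && (code_tnum w * code_level1 w < code_tden w * code_support w i j c))
  | AverageMajority => code_tnum w * (code_level1 w * code_voters w) <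
      code_tden w * \sum_(0 <= i < (size w).+2) (i < code_voters w) * code_support w i j c
  end.

(* Ties are broken by position, so that exactly one token contributes to
   [code_cost]. *)
Definition cheapest Y w j q := wins Y w j (numeral w q 0) && forall_below w (fun q' =>
  wins Y w j (numeral w q' 0) ==> (numeral w q 0 < numeral w q' 0) ||
    ((numeral w q 0 == numeral w q' 0) && (q <= q'))).

Definition code_cost Y w j := \sum_(0 <= q < (size w).+2) cheapest Y w j q * numeral w q 0.

(** If no numeral wins an issue, [code_cost] is an empty sum and the issue would look free; hence
    the separate existence condition. Candidates are all numerals of the word, not only prices of
    issue [j]: extra winning amounts cannot undercut the least one, since below every winning amount
    there is a winning numeral. *)
Definition lobby_ok Y w :=
  forall_below w (fun j => (j < code_issues w) ==>
    ~~ forall_below w (fun q => ~~ wins Y w j (numeral w q 0))) &&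
  (code_voters w * \sum_(0 <= j < (size w).+2) (j < code_issues w) * code_cost Y w j <= code_budget w).

Definition formula Y w := format_ok w && lobby_ok Y w.

Ltac def_macro4 := lazymatch goal with
  | |- definable (fun w rho => numeral w (@?f w rho) (@?g w rho)) =>
      apply: (@def_numeral f g)
  | |- definable (fun w rho => nat_of_bool (canonical_from w (@?f w rho) (@?g w rho))) =>
      apply: (@def_canonical_from f g)
  | |- _ => def_macro3
  end.
Ltac def_macro ::= def_macro4.

Lemma def_code_voters : definable (fun w _ => code_voters w).
Proof. by rewrite /code_voters; solve_definable. Qed.
Lemma def_code_issues : definable (fun w _ => code_issues w).
Proof. by rewrite /code_issues; solve_definable. Qed.
Lemma def_code_level1 : definable (fun w _ => code_level1 w).
Proof. by rewrite /code_level1; solve_definable. Qed.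

Ltac def_macro5 := lazymatch goal with
  | |- definable (fun w rho => code_voters w) => exact: def_code_voters
  | |- definable (fun w rho => code_issues w) => exact: def_code_issues
  | |- definable (fun w rho => code_level1 w) => exact: def_code_level1
  | |- _ => def_macro4
  end.
Ltac def_macro ::= def_macro5.

Lemma def_code_tail : definable (fun w _ => code_tail w).
Proof. by rewrite /code_tail; solve_definable. Qed.

Ltac def_macro6 := lazymatch goal with
  | |- definable (fun w rho => code_tail w) => exact: def_code_tail
  | |- _ => def_macro5
  end.
Ltac def_macro ::= def_macro6.

Lemma def_code_budget : definable (fun w _ => code_budget w).
Proof. by rewrite /code_budget; solve_definable. Qed.
Lemma def_code_tnum : definable (fun w _ => code_tnum w).
Proof. by rewrite /code_tnum; solve_definable. Qed.
Lemma def_code_tden : definable (fun w _ => code_tden w).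
Proof. by rewrite /code_tden; solve_definable. Qed.

Lemma def_code_target f : definable f ->
  definable (fun w rho => nat_of_bool (code_target w (f w rho))).
Proof. by move=> H; rewrite /code_target; solve_definable. Qed.

Lemma def_code_num f g : definable f -> definable g ->
  definable (fun w rho => code_num w (f w rho) (g w rho)).
Proof. by move=> Hf Hg; rewrite /code_num; solve_definable. Qed.

Lemma def_code_den f g : definable f -> definable g ->
  definable (fun w rho => code_den w (f w rho) (g w rho)).
Proof. by move=> Hf Hg; rewrite /code_den; solve_definable. Qed.

Lemma def_code_price f g h : definable f -> definable g -> definable h ->
  definable (fun w rho => code_price w (f w rho) (g w rho) (h w rho)).
Proof. by move=> Hf Hg Hh; rewrite /code_price; solve_definable. Qed.

Ltac def_macro7 := lazymatch goal with
  | |- definable (fun w rho => code_budget w) => exact: def_code_budget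
  | |- definable (fun w rho => code_tnum w) => exact: def_code_tnum
  | |- definable (fun w rho => code_tden w) => exact: def_code_tden
  | |- definable (fun w rho => nat_of_bool (code_target w (@?f w rho))) =>
      apply: (@def_code_target f)
  | |- definable (fun w rho => code_num w (@?f w rho) (@?g w rho)) =>
      apply: (@def_code_num f g)
  | |- definable (fun w rho => code_den w (@?f w rho) (@?g w rho)) =>
      apply: (@def_code_den f g)
  | |- definable (fun w rho => code_price w (@?f w rho) (@?g w rho) (@?h w rho)) =>
      apply: (@def_code_price f g h)
  | |- _ => def_macro6
  end.
Ltac def_macro ::= def_macro7.

Lemma def_code_grid f g : definable f -> definable g ->
  definable (fun w rho => code_grid w (f w rho) (g w rho)).
Proof. by move=> Hf Hg; rewrite /code_grid; solve_definable. Qed.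

Ltac def_macro8 := lazymatch goal with
  | |- definable (fun w rho => code_grid w (@?f w rho) (@?g w rho)) =>
      apply: (@def_code_grid f g)
  | |- _ => def_macro7
  end.
Ltac def_macro ::= def_macro8.

Lemma def_entry_ok f g : definable f -> definable g ->
  definable (fun w rho => nat_of_bool (entry_ok w (f w rho) (g w rho))).
Proof. by move=> Hf Hg; rewrite /entry_ok; solve_definable. Qed.

Lemma def_code_support f g h : definable f -> definable g -> definable h ->
  definable (fun w rho => code_support w (f w rho) (g w rho) (h w rho)).
Proof. by move=> Hf Hg Hh; rewrite /code_support; solve_definable. Qed.

Ltac def_macro9 := lazymatch goal with
  | |- definable (fun w rho => nat_of_bool (entry_ok w (@?f w rho) (@?g w rho))) =>
      apply: (@def_entry_ok f g)
  | |- definable (fun w rho => code_support w (@?f w rho) (@?g w rho) (@?h w rho)) =>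
      apply: (@def_code_support f g h)
  | |- _ => def_macro8
  end.
Ltac def_macro ::= def_macro9.

Lemma def_wins Y f g : definable f -> definable g ->
  definable (fun w rho => nat_of_bool (wins Y w (f w rho) (g w rho))).
Proof. by case: Y => Hf Hg; rewrite /wins; solve_definable. Qed.

Ltac def_macro10 := lazymatch goal with
  | |- definable (fun w rho => nat_of_bool (wins ?Y w (@?f w rho) (@?g w rho))) =>
      apply: (@def_wins Y f g)
  | |- _ => def_macro9
  end.
Ltac def_macro ::= def_macro10.

Lemma def_cheapest Y f g : definable f -> definable g ->
  definable (fun w rho => nat_of_bool (cheapest Y w (f w rho) (g w rho))).
Proof. by move=> Hf Hg; rewrite /cheapest; solve_definable. Qed.

Ltac def_macro11 := lazymatch goal with
  | |- definable (fun w rho => nat_of_bool (cheapest ?Y w (@?f w rho) (@?g w rho))) =>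
      apply: (@def_cheapest Y f g)
  | |- _ => def_macro10
  end.
Ltac def_macro ::= def_macro11.

Lemma def_formula Y : definable (fun w _ => formula Y w).
Proof.
rewrite /formula /format_ok /words_ok /lobby_ok /num_tokens /code_cost.
solve_definable.
Qed.

Theorem formula_polytime Y (L : seq symbol -> Prop) :
  (forall w, formula Y w <-> L w) -> polytime_decidable L.
Proof.
move=> HL; have [t Ht] := def_formula Y.
apply: (@term_polytime t) => w; rewrite Ht; first by case: (formula _ _).
by rewrite -HL; case: (formula _ _).
Qed.

(** * Words as lists of numerals *)

Definition word_of (T : seq (seq bool)) : seq symbol :=
  flatten [seq rcons [seq Some b | b <- t] None | t <- T].

Lemma enc_cat T1 T2 : word_of (T1 ++ T2) = word_of T1 ++ word_of T2.
Proof. by rewrite /word_of map_cat flatten_cat. Qed.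

Lemma enc_cons t T : word_of (t :: T) = [seq Some b | b <- t] ++ None :: word_of T.
Proof. by rewrite /word_of /= cat_rcons. Qed.

Lemma enc_flatten Ts : word_of (flatten Ts) = flatten [seq word_of T | T <- Ts].
Proof. by elim: Ts => //= T Ts IH; rewrite enc_cat IH. Qed.

Definition token (T : seq (seq bool)) q := nth [::] T q.

Lemma size_enc_take T q : q < size T ->
  size (word_of (take q.+1 T)) = (size (word_of (take q T)) + size (token T q)).+1.
Proof.
move=> Hq; rewrite (take_nth [::] Hq) -cats1 enc_cat size_cat enc_cons size_cat size_map /=.
by rewrite addn1 addnS.
Qed.

Lemma enc_drop T q : q < size T ->
  word_of T = word_of (take q T) ++ [seq Some b | b <- token T q] ++ None :: word_of (drop q.+1 T).
Proof.
by move=> Hq; rewrite -enc_cons -enc_cat -[in LHS](cat_take_drop q T) (drop_nth [::] Hq).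
Qed.

Lemma letter_cat_lt s1 s2 p : p < size s1 -> letter (s1 ++ s2) p = letter s1 p.
Proof. by move=> Hp; rewrite /letter drop_cat Hp (drop_nth None Hp). Qed.

Lemma letter_cat_ge s1 s2 p : letter (s1 ++ s2) (size s1 + p) = letter s2 p.
Proof. by rewrite /letter drop_cat ltnNge leq_addr /= addKn. Qed.

Lemma letter_oversize w p : size w <= p -> letter w p = 0.
Proof. by move=> Hp; rewrite /letter drop_oversize. Qed.

Lemma letter_eq0 w p : (letter w p == 0) = (size w <= p).
Proof.
case: leqP => Hp; first by rewrite letter_oversize.
by rewrite /letter (drop_nth None Hp) /=; case: (nth _ _ _).
Qed.

Lemma letter_eq1 w p : (letter w p == 1) = (p < size w) && (nth (Some true) w p == None).
Proof.
case: ltnP => Hp; last by rewrite letter_oversize.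
by rewrite /letter (drop_nth (Some true) Hp) /=; case: (nth _ _ _).
Qed.

Lemma sum_ltn (n m : nat) : m <= n -> \sum_(0 <= p < n) (p < m) = m.
Proof.
move=> Hm; rewrite (big_cat_nat _ (n := m)) //=.
rewrite (eq_big_nat _ _ (F2 := fun=> 1)); last by move=> p /andP[_ ->].
rewrite sum_nat_const_nat subn0 muln1.
rewrite big_nat_cond big1 ?addn0 // => p /andP[/andP[Hp _] _].
by rewrite ltnNge Hp.
Qed.

Lemma separators_take w p : separators w p = count_mem None (take p w).
Proof.
rewrite /separators; have : size w <= (size w).+2 by lia.
move: (size w).+2 => n; elim: n w p => [|n IH] w p; first by case: w => // _; rewrite big_nil.
case: w => [|a w] Hw.
  by rewrite big1 // => i _; rewrite letter_oversize // andbF.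
rewrite big_nat_recl //; case: p => [|p] /=.
  by rewrite big1 // => i _; rewrite ltn0.
by rewrite -IH //; congr addn; case: a {Hw} => [[]|].
Qed.

Lemma count_enc T : count_mem None (word_of T) = size T.
Proof.
elim: T => //= t T IH; rewrite enc_cons count_cat /= IH.
by rewrite count_map (eq_count (a2 := pred0)) // count_pred0.
Qed.

Lemma enc_rcons T t : word_of (rcons T t) = rcons (word_of T ++ [seq Some b | b <- t]) None.
Proof. by rewrite -cats1 enc_cat enc_cons -cats1 catA. Qed.

Lemma size_enc_take_le T q : size (word_of (take q T)) <= size (word_of T).
Proof. by rewrite -{2}(cat_take_drop q T) enc_cat size_cat leq_addr. Qed.

(** The first [q] tokens end with the [q]-th separator. It is at or after each of their positions,
    so fewer than [q] separators precede these, while all [q] precede any later position. *)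
Lemma token_start_word_of T q : token_start (word_of T) q = size (word_of (take q T)).
Proof.
set E := word_of (take q T); set w := word_of T.
have Ew : w = E ++ word_of (drop q T) by rewrite -enc_cat cat_take_drop.
have HE : size E <= size w by exact: size_enc_take_le.
rewrite -(@sum_ltn (size w).+2 (size E)); last by lia.
apply: eq_bigr => p _; congr nat_of_bool; rewrite separators_take letter_eq0 -ltnNge.
case: (ltnP p (size E)) => Hp.
  rewrite (leq_trans Hp HE) Ew takel_cat ?(ltnW Hp) //=.
  apply: (@leq_trans (count_mem None E)); last first.
    by rewrite /E count_enc size_take; case: ltnP.
  rewrite -{2}(cat_take_drop p E) count_cat -addn1 leq_add2l -has_count.
  apply/hasP; exists None => //.
  move: Hp; rewrite /E; case/lastP: (take q T) => [|T' t]; first by [].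
  rewrite enc_rcons size_rcons => Hp.
  by rewrite drop_rcons // mem_rcons mem_head.
case: (ltnP p (size w)) => //= Hpw.
have Hq : q < size T.
  rewrite ltnNge; apply/negP => Hq; move: Hp.
  by rewrite /E take_oversize // leqNgt Hpw.
apply/negbTE; rewrite -leqNgt Ew take_cat ltnNge Hp /= count_cat.
by rewrite {1}/E count_enc size_takel ?leq_addr // ltnW.
Qed.

Lemma in_token_word_of T q l : in_token (word_of T) q l = (l < size (token T q)).
Proof.
rewrite /in_token !token_start_word_of; case: (ltnP q (size T)) => Hq.
  by rewrite size_enc_take // ltnS ltn_add2l.
rewrite !take_oversize //; last exact: leqW.
rewrite /token nth_default // ltn0; lia.
Qed.

Lemma token_bit_word_of T q l : l < size (token T q) ->
  token_bit (word_of T) q l = nth false (token T q) l.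
Proof.
move=> Hl; have Hq : q < size T.
  by rewrite ltnNge; apply/negP => Hq; rewrite /token nth_default in Hl.
rewrite /token_bit token_start_word_of (enc_drop Hq) letter_cat_ge letter_cat_lt ?size_map //.
rewrite /letter (drop_nth None) ?size_map // (nth_map false) //=.
by case: (nth _ _ _).
Qed.

Fixpoint bits_value (t : seq bool) : nat := if t is b :: t' then b + 2 * bits_value t' else 0.

Lemma bits_valueE t n : size t <= n ->
  bits_value t = \sum_(0 <= l < n) ((l < size t) && nth false t l) * 2 ^ l.
Proof.
elim: t n => [|b t IH] n Hn.
  by rewrite big1 // => l _; rewrite ltn0.
case: n Hn => // n Hn; rewrite big_nat_recl //= expn0 muln1 (IH n) //.
congr addn; rewrite big_distrr /=; apply: eq_bigr => l _.
by rewrite ltnS expnS mulnCA.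
Qed.

Lemma pow2E w l : l <= (size w).+2 -> pow2 w l = 2 ^ l.
Proof.
move=> Hl; rewrite /pow2 (big_cat_nat _ (n := l)) //=.
rewrite (eq_big_nat _ _ (F2 := fun=> 2)); last by move=> p /andP[_ ->].
rewrite prod_nat_const_nat subn0.
rewrite [X in _ * X]big_nat_cond big1 ?muln1 // => p /andP[/andP[Hp _] _].
by rewrite ltnNge Hp.
Qed.

Lemma size_tok T q : size (token T q) <= size (word_of T).
Proof.
case: (ltnP q (size T)) => Hq; last by rewrite /token nth_default.
by rewrite (enc_drop Hq) !size_cat size_map addnCA leq_addr.
Qed.

Lemma numeral_word_of T q lo : numeral (word_of T) q lo = bits_value (drop lo (token T q)).
Proof.
have Hs : size (drop lo (token T q)) <= (size (word_of T)).+2.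
  by rewrite size_drop; have := size_tok T q; lia.
rewrite (bits_valueE Hs) /numeral; apply: eq_big_nat => l /andP[_ Hl].
rewrite pow2E ?(ltnW Hl) // in_token_word_of size_drop ltn_subRL.
by case: ltnP => //= H; rewrite token_bit_word_of // nth_drop.
Qed.

Lemma num_tokens_word_of T : num_tokens (word_of T) = size T.
Proof.
rewrite -count_enc -[in RHS](take_size (word_of T)) -separators_take /num_tokens /separators.
apply: eq_bigr => i _; congr nat_of_bool.
by case: ltnP => // Hi; rewrite letter_oversize.
Qed.

(** The default [true] accepts the empty digit string, which is the numeral of 0. *)
Lemma canonical_from_word_of T q lo : canonical_from (word_of T) q lo = last true (drop lo (token T q)).
Proof.
apply/forall_belowP/idP => [H|H l Hl].
  have := size_tok T q; case E: (drop lo (token T q)) => [//|b t] Hs.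
  have Esz : size (token T q) = lo + (size t).+1.
    have := congr1 size E; rewrite size_drop /=; lia.
  have /H : size t < (size (word_of T)).+2 by lia.
  rewrite !in_token_word_of Esz ltn_add2l leqnn addnS ltnn /= token_bit_word_of; last by lia.
  by rewrite -nth_drop E (nth_last false (b :: t)).
rewrite !in_token_word_of; case: ltnP => //= H1; case: ltnP => //= H2.
rewrite token_bit_word_of //.
have Esz : size (drop lo (token T q)) = l.+1 by rewrite size_drop; lia.
rewrite -nth_drop; case: (drop _ _) Esz H => [//|b t] [Et] H.
by rewrite -Et (nth_last false (b :: t)).
Qed.

Lemma bits_value_succ t : bits_value (bin_succ t) = (bits_value t).+1.
Proof. by elim: t => //= [[|]] t IH //=; rewrite IH; lia. Qed.

Lemma bits_value_digits n : bits_value (bin_digits n) = n.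
Proof. by elim: n => //= n IH; rewrite bits_value_succ IH. Qed.

Lemma last_succ t : last true t -> last true (bin_succ t).
Proof.
elim: t => // [[|]] t IH //=; last by case: t {IH}.
move=> H; have := IH H; case: (bin_succ t) (bits_value_succ t) => //=.
Qed.

Lemma canon_digits n : last true (bin_digits n).
Proof. by elim: n => //= n; apply: last_succ. Qed.

(** Uniqueness of binary notation. A nonempty string whose last digit is 1 has positive value, so it
    cannot share its value with the empty one. *)
Lemma canon_inj t t' : last true t -> last true t' -> bits_value t = bits_value t' -> t = t'.
Proof.
have gt0 (b : bool) s : last b s -> 0 < bits_value (b :: s).
  elim: s b => [|c s IH] b /=; first by move=> ->.
  by move/IH => /=; lia.
elim: t t' => [|b t IH] [|b' t'] //= H H' E.
- by have := gt0 _ _ H'; rewrite /= -E.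
- by have := gt0 _ _ H; rewrite /= E.
have Eb : b = b' by move: E; case: (b); case: (b'); lia.
subst b'; congr cons; apply: IH.
- by case: t H {E} => //.
- by case: t' H' {E} => //.
- lia.
Qed.

Lemma digits_bits_value t : last true t -> bin_digits (bits_value t) = t.
Proof.
by move=> H; apply: canon_inj H _; rewrite ?canon_digits ?bits_value_digits.
Qed.

Lemma enc_surj w : words_ok w -> exists T, w = word_of T.
Proof.
move=> /forall_belowP H.
(* The default [None] lets the empty word count as ending with a separator. *)
have {H} : last None w = None.
  case/lastP E: w => [//|s a]; rewrite last_rcons.
  have /H : size s < (size w).+2 by rewrite E size_rcons; lia.
  rewrite E letter_eq1 !letter_eq0 size_rcons ltnn ltnSn ?leqnn /=.
  by rewrite nth_rcons ltnn eqxx => /eqP.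
elim: w => [|a w IH] /=; first by exists [::].
case: w IH => [|b w] IH H.
  by exists [:: [::]]; rewrite /= in H; rewrite H.
have [T ET] := IH H; case: a {H} => [c|]; last first.
  by exists ([::] :: T); rewrite enc_cons ET.
case: T ET => // t T ET; exists ((c :: t) :: T).
by rewrite ET !enc_cons.
Qed.

Lemma words_ok_enc T : words_ok (word_of T).
Proof.
apply/forall_belowP => p Hp; rewrite !letter_eq0 letter_eq1 -ltnNge.
case: ltnP => //= H1; apply/implyP => H2.
case/lastP: T H1 H2 {Hp} => [//|T t].
rewrite enc_rcons size_rcons => H1 H2.
have -> : p = size (word_of T ++ [seq Some b | b <- t]).
  by apply/eqP; rewrite eqn_leq -ltnS H1 -ltnS H2.
by rewrite nth_rcons ltnn eqxx.
Qed.

(** * Codes of lobbying instances *)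

Lemma size_flat X c (ss : seq (seq X)) : all (fun s => size s == c) ss ->
  size (flatten ss) = size ss * c.
Proof. by elim: ss => //= s ss IH /andP[/eqP Hs /IH E]; rewrite size_cat Hs E mulSn. Qed.

Lemma nth_flat X (x0 : X) c (ss : seq (seq X)) q l :
  all (fun s => size s == c) ss ->
  l < c -> nth x0 (flatten ss) (q * c + l) = nth x0 (nth [::] ss q) l.
Proof.
move=> + Hl; elim: ss q => [|s ss IH] q /=; first by rewrite !nth_nil.
case/andP=> /eqP Hs H; rewrite nth_cat Hs; case: q => [|q] /=.
  by rewrite mul0n Hl.
by rewrite mulSn -addnA ltnNge leq_addr addKn IH.
Qed.

Lemma all_size_map X Y (r : seq Y) (F : Y -> seq X) c :
  (forall y, size (F y) = c) -> all (fun s => size s == c) (map F r).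
Proof. by move=> H; elim: r => //= y r ->; rewrite H eqxx. Qed.

Section Blocks.

Variables (m n c : nat).

Definition blocks X (F : 'I_m -> 'I_n -> seq X) : seq X :=
  flatten [seq F i j | i <- enum 'I_m, j <- enum 'I_n].

Lemma nth_allpairs_ord Y (y0 : Y) (F : 'I_m -> 'I_n -> Y) (i : 'I_m) (j : 'I_n) :
  nth y0 [seq F i j | i <- enum 'I_m, j <- enum 'I_n] (i * n + j) = F i j.
Proof.
rewrite (@nth_flat _ _ n) //; last first.
  by apply: all_size_map => k; rewrite size_map size_enum_ord.
rewrite (nth_map i) ?size_enum_ord // nth_ord_enum.
by rewrite (nth_map j) ?size_enum_ord // nth_ord_enum.
Qed.

Lemma all_allpairs_ord Y (F : 'I_m -> 'I_n -> seq Y) :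
  (forall i j, size (F i j) = c) -> all (fun s => size s == c)
    [seq F i j | i <- enum 'I_m, j <- enum 'I_n].
Proof.
move=> H; elim: (enum 'I_m) => //= i r IH; rewrite all_cat IH andbT.
exact: all_size_map.
Qed.

Lemma size_blocks X (F : 'I_m -> 'I_n -> seq X) :
  (forall i j, size (F i j) = c) -> size (blocks F) = m * n * c.
Proof.
move=> H; rewrite (size_flat (all_allpairs_ord H)).
by rewrite size_allpairs !size_enum_ord.
Qed.

Lemma nth_blocks X (x0 : X) (F : 'I_m -> 'I_n -> seq X) (i : 'I_m) (j : 'I_n) l :
  (forall i j, size (F i j) = c) -> l < c ->
  nth x0 (blocks F) ((i * n + j) * c + l) = nth x0 (F i j) l.
Proof.
move=> H Hl; rewrite nth_flat ?nth_allpairs_ord //; exact: all_allpairs_ord.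
Qed.

(** The decoding counterpart of [nth_blocks]: the position of an entry determines row, column and
    offset by division with remainder, so any list of the right length is a table. *)
Lemma blocks_eta X (x0 : X) (S : seq X) : size S = m * n * c ->
  S = blocks (fun i j => mkseq (fun l => nth x0 S ((i * n + j) * c + l)) c).
Proof.
move=> HS; have Hsz i j : size (mkseq (fun l => nth x0 S ((i * n + j) * c + l)) c) = c.
  exact: size_mkseq.
have Hb : size (blocks (fun i j => mkseq (fun l => nth x0 S ((i * n + j) * c + l)) c)) = m * n * c.
  by apply: size_blocks => i j; exact: size_mkseq.
apply: (@eq_from_nth _ x0); first by rewrite HS Hb.
rewrite HS => q Hq.
have c0 : 0 < c by case: (c) Hq => //; rewrite muln0.
have n0 : 0 < n by case: (n) Hq => //; rewrite muln0.
have Hi : q %/ c %/ n < m.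
  by rewrite !ltn_divLR.
have Hj : q %/ c %% n < n by rewrite ltn_mod.
have Hl : q %% c < c by rewrite ltn_mod.
have E : q = (Ordinal Hi * n + Ordinal Hj) * c + q %% c.
  by rewrite /= -divn_eq -divn_eq.
rewrite [in RHS]E nth_blocks //.
by rewrite nth_mkseq // -E.
Qed.

End Blocks.

(** Numerators and denominators are parameters because the code of a fraction is not determined by
    its value. *)
Definition lobbying_tokens (x : lobbying) (a b : 'I_(voters x) -> 'I_(issues x) -> nat)
    (ta tb : nat) : seq (seq bool) :=
  [:: bin_digits (voters x); bin_digits (issues x); bin_digits (level x)]
  ++ blocks (fun i j => [:: bin_digits (a i j); bin_digits (b i j)])
  ++ blocks (fun i j => [seq bin_digits (price x i j l) | l <- enum 'I_(level x).+2])
  ++ [:: [seq target x j | j <- enum 'I_(issues x)]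
         ++ (budget x < 0)%R :: bin_digits `|budget x|; bin_digits ta; bin_digits tb].

Lemma enc_digits a : word_of [:: bin_digits a] = nat_code a.
Proof. by rewrite /word_of /= cats0. Qed.

Lemma enc_blocks m n (F : 'I_m -> 'I_n -> seq (seq bool)) :
  word_of (blocks F) = flatten [seq word_of (F i j) | i <- enum 'I_m, j <- enum 'I_n].
Proof. by rewrite enc_flatten map_allpairs. Qed.

Lemma enc_toks x a b ta tb : word_of (@lobbying_tokens x a b ta tb) =
  nat_code (voters x) ++ nat_code (issues x) ++ nat_code (level x)
   ++ flatten [seq nat_code (a i j) ++ nat_code (b i j)
              | i <- enum 'I_(voters x), j <- enum 'I_(issues x)]
   ++ flatten [seq flatten [seq nat_code (price x i j l)
                                  | l <- enum 'I_(level x).+2]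
                     | i <- enum 'I_(voters x), j <- enum 'I_(issues x)]
   ++ [seq Some (target x j) | j <- enum 'I_(issues x)]
   ++ int_code (budget x) ++ nat_code ta ++ nat_code tb.
Proof.
rewrite /lobbying_tokens !enc_cat !enc_blocks -!enc_digits.
have -> : [seq word_of [:: bin_digits (a i j); bin_digits (b i j)]
      | i <- enum 'I_(voters x), j <- enum 'I_(issues x)] =
    [seq nat_code (a i j) ++ nat_code (b i j)
      | i <- enum 'I_(voters x), j <- enum 'I_(issues x)].
  by apply: eq_allpairs => i j; rewrite -!enc_digits -enc_cat.
have -> : [seq word_of [seq bin_digits (price x i j l) | l <- enum 'I_(level x).+2]
      | i <- enum 'I_(voters x), j <- enum 'I_(issues x)] =
    [seq flatten [seq nat_code (price x i j l) | l <- enum 'I_(level x).+2]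
      | i <- enum 'I_(voters x), j <- enum 'I_(issues x)].
  apply: eq_allpairs => i j; rewrite -[word_of _]/(flatten _) -map_comp.
  by congr (flatten _); apply: eq_map => l.
rewrite -[[:: bin_digits (voters x); _; _]]/([:: bin_digits (voters x)] ++ [:: bin_digits (issues x)] ++ [:: bin_digits (level x)]).
rewrite !enc_cat -!catA; do 3 congr (_ ++ _).
rewrite enc_cons map_cat -map_comp -catA.
do 3 congr (_ ++ _).
by rewrite /int_code /nat_code !enc_cons /= !cat_rcons.
Qed.

Lemma code_toks x w : is_lobbying_code x w <-> exists a b ta tb,
  [/\ forall i j, (0 < b i j) /\ prob x i j = ((a i j)%:R / (b i j)%:R)%R,
      (0 < tb) /\ threshold x = (ta%:R / tb%:R)%R & w = word_of (@lobbying_tokens x a b ta tb)].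
Proof.
split=> [[pc [tc [Hpc Htc ->]]]|[a [b [ta [tb [Hab [tb0 Ht] ->]]]]]]; last first.
  exists (fun i j => nat_code (a i j) ++ nat_code (b i j)), (nat_code ta ++ nat_code tb).
  split; last by rewrite enc_toks.
    by move=> i j; have [b0 E] := Hab i j; exists (a i j), (b i j).
  by exists ta, tb.
(* Each entry only comes with the existence of a numerator and a denominator; finite choice turns
   these into functions of the entry. *)
have Hpc' i : exists ab : 'I_(issues x) -> nat * nat, forall j,
    [/\ 0 < (ab j).2, prob x i j = ((ab j).1%:R / (ab j).2%:R)%R &
      pc i j = nat_code (ab j).1 ++ nat_code (ab j).2].
  apply: (@fin_all_exists _ _ (fun j (ab : nat * nat) => [/\ 0 < ab.2,
    prob x i j = (ab.1%:R / ab.2%:R)%R & pc i j = nat_code ab.1 ++ nat_code ab.2])) => j.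
  by have [a [b [b0 E1 E2]]] := Hpc i j; exists (a, b).
have [ab Hab] := fin_all_exists Hpc'.
have [ta [tb [tb0 Et Etc]]] := Htc.
exists (fun i j => (ab i j).1), (fun i j => (ab i j).2), ta, tb; split=> //.
  by move=> i j; have [H1 H2 _] := Hab i j.
rewrite enc_toks Etc; do 4 congr (_ ++ _).
by congr (flatten _); apply: eq_allpairs => i j; have [_ _ ->] := Hab i j.
Qed.

(** * From codes to the formula *)

Import Order.TTheory GRing.Theory Num.Theory.


Section Fractions.

Local Open Scope ring_scope.

Lemma frac_le1 (a b : nat) : (0 < b)%N -> (0 <= (a%:R / b%:R : rat) <= 1) = (a <= b)%N.
Proof.
by move=> b0; rewrite divr_ge0 ?ler0n // ler_pdivrMr ?ltr0n // mul1r ler_nat.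
Qed.

Lemma frac_eq (a b c d : nat) : (0 < b)%N -> (0 < d)%N ->
  (a%:R / b%:R == c%:R / d%:R :> rat) = (a * d == c * b)%N.
Proof.
move=> b0 d0; rewrite eqr_div ?pnatr_eq0 -?lt0n // -!natrM eqr_nat.
by rewrite [(c * b)%N]mulnC.
Qed.

Lemma frac_lt (a b c d : nat) : (0 < b)%N -> (0 < d)%N ->
  (a%:R / b%:R < c%:R / d%:R :> rat) = (a * d < c * b)%N.
Proof.
move=> b0 d0; rewrite ltr_pdivrMr ?ltr0n // mulrAC ltr_pdivlMr ?ltr0n //.
by rewrite -!natrM ltr_nat.
Qed.

(** Both sides say that (a / b) k is an integer; from there, coprimality of reduced numerator and
    denominator yields the divisibility. *)
Lemma denq_frac_dvd (a b k : nat) : (0 < b)%N -> (0 < k)%N ->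
  (denq (a%:R / b%:R) %| k%:Z)%Z <-> exists e : nat, (a * k = e * b)%N.
Proof.
move=> b0 k0; set p : rat := a%:R / b%:R.
have Ep : p * b%:R = a%:R by rewrite /p divfK // pnatr_eq0 -lt0n.
have En := numqE p.
split=> [/dvdzP[c Ec]|[e Ee]].
  exists (absz (numq p * c)).
  have : (a * k)%:Z = numq p * c * b%:Z.
    apply: (@intr_inj rat); rewrite PoszM Ec !rmorphM /= En -!pmulrn -Ep; ring.
  by move/(congr1 absz); rewrite abszM.
have Epk : p * k%:R = e%:R.
  apply/eqP; rewrite -[_ * _]divr1 -[e%:R]divr1.
  have b0' : b%:R != 0 :> rat by rewrite pnatr_eq0 -lt0n.
  rewrite !divr1 -(inj_eq (mulIf b0')) mulrAC Ep -!natrM eqr_nat; exact/eqP.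
have E : numq p * k%:Z = e%:Z * denq p.
  apply: (@intr_inj rat); rewrite !rmorphM /= En -!pmulrn -Epk; ring.
rewrite -(Gauss_dvdzr (n := numq p)); last first.
  by rewrite coprimezE coprime_sym coprime_num_den.
by rewrite E dvdz_mull.
Qed.

Lemma grid_le k (a b : 'I_k.+2) : (grid_value a <= grid_value b) = (a <= b)%N.
Proof. by rewrite /grid_value ler_pM2r ?invr_gt0 ?ltr0n // ler_nat. Qed.

Lemma grid_eq_frac k (a : 'I_k.+2) (c d : nat) : (0 < d)%N ->
  (grid_value a == c%:R / d%:R) = (c * k.+1 == a * d)%N.
Proof. by move=> d0; rewrite frac_eq // eq_sym. Qed.

End Fractions.

(** Holds for encoded as well as for decoded instances, so that one equivalence proof serves both
    directions of [language_formula]. *)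
Definition matches (w : seq symbol) (x : lobbying) : Prop :=
  [/\ code_voters w = voters x, code_issues w = issues x, code_level1 w = (level x).+1,
    forall (i : 'I_(voters x)) (j : 'I_(issues x)),
      (prob x i j = (code_num w i j)%:R / (code_den w i j)%:R)%R /\
      forall a : 'I_(level x).+2, price x i j a = code_price w i j a &
   [/\ forall j : 'I_(issues x), target x j = code_target w j, budget x = Posz (code_budget w) &
     (threshold x = (code_tnum w)%:R / (code_tden w)%:R)%R]].

Lemma size_enc_ge T : size T <= size (word_of T).
Proof. by rewrite -count_enc count_size. Qed.

Lemma all_blocks m n X (p : pred X) (F : 'I_m -> 'I_n -> seq X) :
  (forall i j, all p (F i j)) -> all p (blocks F).
Proof.
move=> H; rewrite /blocks; elim: (enum 'I_m) => //= i r IH.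
rewrite flatten_cat all_cat IH andbT; elim: (enum 'I_n) => //= j s IHs.
by rewrite all_cat H.
Qed.

Lemma bits_value_drop0 t : bits_value (drop 0 t) = bits_value t.
Proof. by rewrite drop0. Qed.

Section Tokens.

Variables (x : lobbying) (a b : 'I_(voters x) -> 'I_(issues x) -> nat) (ta tb : nat).
Let T := lobbying_tokens a b ta tb.
Let w := word_of T.
Let m := voters x.
Let n := issues x.
Let Q := 3 + (2 * (m * n) + m * n * (level x).+2).
Let tQ := [seq target x j | j <- enum 'I_n] ++ (budget x < 0)%R :: bin_digits `|budget x|.

Let SA := blocks (fun i j => [:: bin_digits (a i j); bin_digits (b i j)]).
Let SC := blocks (fun i j => [seq bin_digits (price x i j l) | l <- enum 'I_(level x).+2]).

Let size_SA : size SA = 2 * (m * n).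
Proof. by rewrite (@size_blocks m n 2) // mulnC. Qed.

Let size_SC : size SC = m * n * (level x).+2.
Proof. by rewrite (@size_blocks m n (level x).+2) // => i j; rewrite size_map size_enum_ord. Qed.

Let T_split : T = ([:: bin_digits m; bin_digits n; bin_digits (level x)] ++ SA ++ SC)
  ++ [:: tQ; bin_digits ta; bin_digits tb].
Proof. by rewrite /T /lobbying_tokens -!catA. Qed.

Let size_pre : size ([:: bin_digits m; bin_digits n; bin_digits (level x)] ++ SA ++ SC) = Q.
Proof. by rewrite !size_cat size_SA size_SC. Qed.

Lemma size_toks : size T = 3 + Q.
Proof. by rewrite T_split size_cat size_pre addnC. Qed.

Let tok_post l : token T (Q + l) = nth [::] [:: tQ; bin_digits ta; bin_digits tb] l.
Proof. by rewrite /token T_split nth_cat size_pre ltnNge leq_addr addKn. Qed.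

Let tok_T3 q : token T (3 + q) = nth [::] (SA ++ SC ++ [:: tQ; bin_digits ta; bin_digits tb]) q.
Proof. by []. Qed.

Let tok_A (i : 'I_m) (j : 'I_n) l : l < 2 ->
  token T (3 + (2 * (i * n + j) + l)) = nth [::] [:: bin_digits (a i j); bin_digits (b i j)] l.
Proof.
move=> Hl; rewrite tok_T3 nth_cat size_SA.
have Hi := ltn_ord i; have Hj := ltn_ord j.
have Hlt : i * n + j < m * n by nia.
rewrite ifT; last by lia.
by rewrite [2 * _]mulnC /SA (@nth_blocks m n 2 _ [::]).
Qed.

Let tok_C (i : 'I_m) (j : 'I_n) (l : 'I_(level x).+2) :
  token T (3 + 2 * (m * n) + ((i * n + j) * (level x).+2 + l)) = bin_digits (price x i j l).
Proof.
have Hi := ltn_ord i; have Hj := ltn_ord j; have Hl := ltn_ord l.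
rewrite -addnA tok_T3 nth_cat size_SA.
rewrite ltnNge leq_addr /= addKn nth_cat size_SC.
have Hlt : (i * n + j).+1 * (level x).+2 <= m * n * (level x).+2.
  by rewrite leq_mul2r; apply/orP; right; nia.
rewrite ifT; last by rewrite mulSn in Hlt; lia.
rewrite /SC (@nth_blocks m n (level x).+2 _ [::]) //; last first.
  by move=> i' j'; rewrite size_map size_enum_ord.
by rewrite (nth_map l) ?size_enum_ord // nth_ord_enum.
Qed.

Let Em : code_voters w = m.
Proof. by rewrite /code_voters numeral_word_of bits_value_drop0 bits_value_digits. Qed.
Let En : code_issues w = n.
Proof. by rewrite /code_issues numeral_word_of bits_value_drop0 bits_value_digits. Qed.
Let Ek : code_level1 w = (level x).+1.
Proof. by rewrite /code_level1 numeral_word_of bits_value_drop0 bits_value_digits. Qed.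
Let EQ : code_tail w = Q. Proof. by rewrite /code_tail Em En Ek. Qed.

Let EA (i : 'I_m) (j : 'I_n) : code_num w i j = a i j.
Proof.
by rewrite /code_num En numeral_word_of -[2 * _]addn0 tok_A // bits_value_drop0 bits_value_digits.
Qed.

Let EB (i : 'I_m) (j : 'I_n) : code_den w i j = b i j.
Proof.
rewrite /code_den En numeral_word_of -[4 + _]/(3 + 1 + _) -addnA [1 + _]addnC tok_A //.
by rewrite bits_value_drop0 bits_value_digits.
Qed.

Let EC (i : 'I_m) (j : 'I_n) (l : 'I_(level x).+2) : code_price w i j l = price x i j l.
Proof. by rewrite /code_price Em En Ek numeral_word_of tok_C bits_value_drop0 bits_value_digits. Qed.

Let tokQ : token T Q = tQ. Proof. by rewrite -[Q]addn0 tok_post. Qed.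

Let Ez (j : 'I_n) : code_target w j = target x j.
Proof.
rewrite /code_target EQ token_bit_word_of; last first.
  rewrite tokQ /tQ size_cat size_map size_enum_ord; exact: ltn_addr (ltn_ord j).
rewrite tokQ /tQ nth_cat size_map size_enum_ord ltn_ord (nth_map j) ?size_enum_ord //.
by rewrite nth_ord_enum.
Qed.

Let Eta : code_tnum w = ta.
Proof. by rewrite /code_tnum EQ numeral_word_of -addn1 tok_post bits_value_drop0 bits_value_digits. Qed.

Let Etb : code_tden w = tb.
Proof. by rewrite /code_tden EQ numeral_word_of -addn2 tok_post bits_value_drop0 bits_value_digits. Qed.

Let drop_tQ : drop n.+1 tQ = bin_digits `|budget x|.
Proof.
by rewrite /tQ drop_cat size_map size_enum_ord ltnNge leqnSn subSnn /= drop0.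
Qed.

Let Ebud : code_budget w = `|budget x|.
Proof. by rewrite /code_budget EQ En numeral_word_of tokQ drop_tQ bits_value_digits. Qed.

Hypothesis ab_ok : forall i j, (0 < b i j) /\ prob x i j = ((a i j)%:R / (b i j)%:R)%R.
Hypothesis t_ok : (0 < tb) /\ threshold x = (ta%:R / tb%:R)%R.
Hypothesis budget_ge0 : (0 <= budget x)%R.

Lemma toks_matches : matches w x.
Proof.
split=> // [i j|]; first by rewrite EA EB; split=> [|l]; [case: (ab_ok i j) | rewrite EC].
by split=> [j||]; rewrite ?Ez ?Ebud ?Eta ?Etb //; [exact/esym/gez0_abs | case: t_ok].
Qed.

Lemma toks_entry_ok (i : 'I_m) (j : 'I_n) : entry_ok w i j.
Proof.
have [b0 Ep] := ab_ok i j.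
have Hab : a i j <= b i j by have := prob_in01 i j; rewrite Ep frac_le1.
have /(denq_frac_dvd _ b0 (ltn0Sn _)) [e Ee] : (denq ((a i j)%:R / (b i j)%:R) %| (level x).+1%:Z)%Z.
  by rewrite -Ep; exact: prob_admissible.
have He : e < (level x).+2 by rewrite ltnS -(leq_pmul2r b0) -Ee mulnC leq_mul2l Hab orbT.
(* The word contains a line of [level + 2] prices for this entry, so the bounded sum in [code_grid]
   reaches far enough. *)
have HN : (level x).+2 <= (size w).+2.
  have := size_enc_ge T; rewrite size_toks -/w /Q.
  have Hi := ltn_ord i; have Hj := ltn_ord j.
  have : 1 * (level x).+2 <= m * n * (level x).+2 by rewrite leq_mul2r muln_gt0; lia.
  lia.
have Eg : code_grid w i j = e.
  rewrite /code_grid EA EB Ek -[RHS](@sum_ltn (size w).+2 e); last by lia.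
  by apply: eq_bigr => y _; rewrite Ee leq_pmul2r.
pose e' := Ordinal He.
have Epe : grid_value e' = prob x i j by apply/eqP; rewrite Ep grid_eq_frac // Ee.
rewrite /entry_ok Eg EA EB Ek b0 Hab Ee eqxx /=; apply/andP; split.
  by rewrite (EC i j e') (price_start Epe).
apply/forall_belowP => l _; apply/forall_belowP => l' _; apply/implyP => /andP[Hl Hl'].
apply/implyP => H.
rewrite (EC i j (Ordinal (Hl : l < (level x).+2))) (EC i j (Ordinal (Hl' : l' < (level x).+2))).
by apply: price_mono; rewrite -Epe !grid_le.
Qed.

Lemma toks_format_ok : format_ok w.
Proof.
have [tb0 Et] := t_ok.
rewrite /format_ok words_ok_enc num_tokens_word_of EQ size_toks eqxx En in_token_word_of tokQ.
have HnQ : n < size tQ by rewrite size_cat size_map size_enum_ord addnS ltnS leq_addr.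
rewrite HnQ token_bit_word_of tokQ //= {1}/tQ.
rewrite nth_cat size_map size_enum_ord ltnn subnn /= ltNge budget_ge0 /=.
rewrite canonical_from_word_of tokQ drop_tQ canon_digits Em Etb tb0 voters_gt0 Eta /=.
apply/and3P; split; last first.
- apply/forall_belowP => i _; apply/forall_belowP => j _; apply/implyP => /andP[Hi Hj].
  exact: (toks_entry_ok (Ordinal Hi) (Ordinal Hj)).
- by have := threshold_in01 x; rewrite Et frac_le1.
apply/forall_belowP => q Hq; apply/implyP => /andP[HqT HqQ]; rewrite canonical_from_word_of drop0.
have Hpre : all (last true) ([:: bin_digits m; bin_digits n; bin_digits (level x)] ++ SA ++ SC).
  rewrite !all_cat /= !canon_digits /=; apply/andP; split; apply: all_blocks => i j /=.
    by rewrite !canon_digits.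
  by elim: (enum _) => //= l r ->; rewrite canon_digits.
case: (ltngtP q Q) HqQ => // Hlt _.
  rewrite /token T_split nth_cat size_pre Hlt.
  by apply: (allP Hpre); rewrite mem_nth // size_pre.
have -> : q = Q + (q - Q) by lia.
rewrite tok_post; have : 0 < q - Q < 3 by lia.
by case: (q - Q) => [|[|[|]]] //=; rewrite canon_digits.
Qed.

End Tokens.

(** * Decoding *)


Lemma eq_blocks m n X (F1 F2 : 'I_m -> 'I_n -> seq X) :
  (forall i j, F1 i j = F2 i j) -> blocks F1 = blocks F2.
Proof. by move=> E; congr flatten; apply: eq_allpairs => i j. Qed.

(** The indices [i] and [j] witness that the tables have an entry. Then m, n and the length of a
    price line are at most the number of tokens, hence bounded by the length of the word; without
    issues this would fail. *)
Lemma format_bounds w i j : format_ok w -> i < code_voters w -> j < code_issues w ->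
  [/\ code_voters w <= size w, code_issues w <= size w & code_level1 w < size w].
Proof.
case/and4P => /enc_surj [T ->] + _ _; set w' := word_of T.
rewrite num_tokens_word_of => /eqP HT Hi Hj.
have := size_enc_ge T; rewrite HT -/w' /code_tail => H.
have H1 : code_voters w' <= code_voters w' * code_issues w' by rewrite leq_pmulr //; lia.
have H2 : code_issues w' <= code_voters w' * code_issues w' by rewrite leq_pmull //; lia.
have H3 : (code_level1 w').+1 <= code_voters w' * code_issues w' * (code_level1 w').+1 by rewrite leq_pmull // muln_gt0; lia.
by split; lia.
Qed.

Lemma format_entry w i j : format_ok w -> i < code_voters w -> j < code_issues w -> entry_ok w i j.
Proof.
move=> Hf Hi Hj; have [B1 B2 _] := format_bounds Hf Hi Hj.
move: Hf; rewrite /format_ok => /and5P[_ _ _ _ /and5P[_ _ _ _ /andP[_ /forall_belowP H]]].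
have /H/forall_belowP H' : i < (size w).+2 by lia.
have /H' : j < (size w).+2 by lia.
by rewrite Hi Hj.
Qed.

Lemma format_mono w i j a b : format_ok w -> i < code_voters w -> j < code_issues w ->
  a <= code_level1 w -> b <= code_level1 w ->
  (code_grid w i j <= a <= b) || (b <= a <= code_grid w i j) -> code_price w i j a <= code_price w i j b.
Proof.
move=> Hf Hi Hj Ha Hb; have [_ _ B3] := format_bounds Hf Hi Hj.
have /and5P[_ _ _ _ /forall_belowP H] := format_entry Hf Hi Hj.
have /H/forall_belowP H' : a < (size w).+2 by lia.
have /H' : b < (size w).+2 by lia.
by rewrite Ha Hb /= => /implyP.
Qed.

Section Decode.

Variable T : seq (seq bool).
Let w := word_of T.
Hypothesis Hf : format_ok w.
Let m := code_voters w.
Let n := code_issues w.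
Let k := numeral w 2 0.

Let size_T : size T = 3 + code_tail w.
Proof. by move: Hf; rewrite /format_ok => /and3P[_ /eqP <- _]; rewrite num_tokens_word_of. Qed.

Let tok_digits q : q < size T -> q != code_tail w -> token T q = bin_digits (numeral w q 0).
Proof.
move=> Hq HqQ; rewrite numeral_word_of drop0 digits_bits_value //.
move: Hf; rewrite /format_ok => /and4P[_ _ /forall_belowP H _].
have /H : q < (size w).+2 by have := size_enc_ge T; rewrite -/w; lia.
by rewrite num_tokens_word_of Hq HqQ /= canonical_from_word_of drop0.
Qed.

Let S := drop 3 T.
Let SA := take (m * n * 2) S.
Let SC := take (m * n * k.+2) (drop (m * n * 2) S).

Let EQ : code_tail w = 3 + (2 * (m * n) + m * n * k.+2).
Proof. by []. Qed.

Let size_S : size S = 2 * (m * n) + m * n * k.+2 + 3.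
Proof. by rewrite size_drop size_T EQ; lia. Qed.

Let size_SA : size SA = m * n * 2.
Proof. by rewrite size_takel // size_S; lia. Qed.

Let size_SC : size SC = m * n * k.+2.
Proof. by rewrite size_takel // size_drop size_S; lia. Qed.

Let nth_S q : nth [::] S q = token T (3 + q).
Proof. by rewrite nth_drop. Qed.

Let index_lt (i : 'I_m) (j : 'I_n) : i * n + j < m * n.
Proof. by have Hi := ltn_ord i; have Hj := ltn_ord j; nia. Qed.

Let SA_blocks : SA = blocks (fun (i : 'I_m) (j : 'I_n) =>
  [:: bin_digits (code_num w i j); bin_digits (code_den w i j)]).
Proof.
rewrite [LHS](blocks_eta [::] size_SA); apply: eq_blocks => i j.
have Hij := index_lt i j.
rewrite /mkseq /= !nth_take; [|lia|lia]; rewrite !nth_S.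
rewrite !tok_digits; [|rewrite size_T EQ; lia|rewrite EQ; lia
  |rewrite size_T EQ; lia|rewrite EQ; lia].
congr [:: bin_digits (numeral w _ 0); bin_digits (numeral w _ 0)]; rewrite -/n; lia.
Qed.

Let SC_blocks : SC = blocks (fun (i : 'I_m) (j : 'I_n) =>
  [seq bin_digits (code_price w i j l) | l : 'I_k.+2 <- enum 'I_k.+2]).
Proof.
rewrite [LHS](blocks_eta [::] size_SC); apply: eq_blocks => i j.
have Hij := index_lt i j.
apply: (@eq_from_nth _ [::]); first by rewrite size_mkseq size_map size_enum_ord.
rewrite size_mkseq => l Hl.
rewrite nth_mkseq // (nth_map (Ordinal Hl)) ?size_enum_ord //.
rewrite (nth_ord_enum _ (Ordinal Hl)).
have Hlt : (i * n + j) * k.+2 + l < m * n * k.+2.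
  have : (i * n + j).+1 * k.+2 <= m * n * k.+2 by rewrite leq_mul2r Hij orbT.
  by rewrite mulSn; lia.
rewrite nth_take // nth_drop nth_S tok_digits; [|rewrite size_T EQ; lia|rewrite EQ; lia].
congr (bin_digits (numeral w _ 0)); rewrite /= -/n -/m -[code_level1 w]/(k.+1); lia.
Qed.

Let tokQ : token T (code_tail w) =
  [seq code_target w j | j : 'I_n <- enum 'I_n] ++ false :: bin_digits (code_budget w).
Proof.
move: Hf; rewrite /format_ok => /and5P[_ _ _ Hn /and3P[Hb Hc _]].
move: Hn Hb Hc; rewrite in_token_word_of canonical_from_word_of => Hn; rewrite token_bit_word_of // => Hb Hc.
rewrite -[LHS](cat_take_drop n) (drop_nth false) // (negbTE Hb).
rewrite /code_budget numeral_word_of digits_bits_value //; congr cat.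
apply: (@eq_from_nth _ false); first by rewrite size_takel 1?ltnW // size_map size_enum_ord.
rewrite size_takel 1?ltnW // => l Hl.
rewrite nth_take // (nth_map (Ordinal Hl)) ?size_enum_ord //.
by rewrite (nth_ord_enum _ (Ordinal Hl)) /code_target token_bit_word_of // (ltn_trans Hl).
Qed.

Lemma format_code : exists x, [/\ is_lobbying_code x w, matches w x &
  (0 <= budget x)%R].
Proof.
have entry (i : 'I_m) (j : 'I_n) : entry_ok w i j by exact: format_entry.
have [Hm Htb Htab] : [/\ 0 < code_voters w, 0 < code_tden w & code_tnum w <= code_tden w].
  by move: Hf; rewrite /format_ok => /and5P[_ _ _ _ /and5P[_ _ -> -> /andP[->]]].
pose P := (\matrix_(i < m, j < n) ((code_num w i j)%:R / (code_den w i j)%:R : rat))%R.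
have PE i j : P i j = ((code_num w i j)%:R / (code_den w i j)%:R)%R by rewrite mxE.
have H1 i j : (0 <= P i j <= 1)%R.
  by have /and3P[b0 Hab _] := entry i j; rewrite PE frac_le1.
have H2 i j : (denq (P i j) %| (k.+1)%:Z)%Z.
  have /and4P[b0 _ /eqP E _] := entry i j; rewrite PE.
  by apply/denq_frac_dvd => //; exists (code_grid w i j); rewrite E.
pose C (i : 'I_m) (j : 'I_n) (a : 'I_k.+2) := code_price w i j a.
have g_le (i : 'I_m) (j : 'I_n) : code_grid w i j < k.+2.
  have /and4P[b0 Hab /eqP E _] := entry i j.
  by rewrite ltnS -(leq_pmul2r b0) E mulnC leq_mul2l Hab orbT.
have gridE i j (a : 'I_k.+2) : (grid_value a == P i j) = (nat_of_ord a == code_grid w i j).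
  have /and4P[b0 _ /eqP E _] := entry i j.
  by rewrite PE grid_eq_frac // -[k.+1]/(code_level1 w) -E eqn_pmul2r // eq_sym.
have PG i j : P i j = grid_value (Ordinal (g_le i j)).
  by apply/esym/eqP; rewrite gridE.
have H3 i j (a : 'I_k.+2) : grid_value a = P i j -> C i j a = 0.
  move/eqP; rewrite gridE => /eqP Ea; rewrite /C [nat_of_ord a]Ea.
  by have /and5P[_ _ _ /eqP-> _] := entry i j.
have H4 i j (a b : 'I_k.+2) :
    ((P i j <= grid_value a <= grid_value b) ||
     (grid_value b <= grid_value a <= P i j))%R -> C i j a <= C i j b.
  by rewrite !PG !grid_le /=; apply: format_mono => //; rewrite -ltnS ltn_ord.
have H5 : (0 <= ((code_tnum w)%:R / (code_tden w)%:R : rat) <= 1)%R by rewrite frac_le1.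
pose x := @Lobbying m n k Hm P H1 H2 C H3 H4 (fun j => code_target w j) (code_budget w) _ H5.
exists x; split=> //; last first.
apply/code_toks; exists (fun i j => code_num w i j), (fun i j => code_den w i j), (code_tnum w), (code_tden w).
split=> //.
  by move=> i j; have /andP[-> _] := entry i j; rewrite /= PE.
congr word_of; rewrite -[LHS](cat_take_drop 3) -/S -[in LHS](cat_take_drop (m * n * 2) S).
rewrite -/SA -[in LHS](cat_take_drop (m * n * k.+2) (drop (m * n * 2) S)) -/SC.
rewrite /lobbying_tokens; congr (_ ++ _).
  have Ht q : q < 3 -> token T q = bin_digits (numeral w q 0).
    by move=> Hq; apply: tok_digits; rewrite ?size_T EQ; lia.
  case: T (size_T) (Ht 0 isT) (Ht 1 isT) (Ht 2 isT) => [|t0 [|t1 [|t2 T']]] //= _.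
  by rewrite take0 /token /= => -> -> ->.
congr (_ ++ _); first exact: SA_blocks.
congr (_ ++ _); first exact: SC_blocks.
have E3 : size (drop (m * n * k.+2) (drop (m * n * 2) S)) = 3.
  by rewrite 2!size_drop size_S; lia.
have N3 q : nth [::] (drop (m * n * k.+2) (drop (m * n * 2) S)) q = token T (code_tail w + q).
  by rewrite 2!nth_drop nth_S EQ; congr (token T _); lia.
apply: (@eq_from_nth _ [::]); first by rewrite E3.
rewrite E3 => q Hq; rewrite N3.
case: q Hq => [|[|[|]]] // _.
- by rewrite addn0 tokQ.
- by rewrite tok_digits ?size_T ?addn1; [|lia|lia].
- by rewrite tok_digits ?size_T ?addn2; [|lia|lia].
Qed.

End Decode.

(** * Minimal prices *)


Lemma sum_guard (n m : nat) (F : nat -> nat) : m <= n ->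
  \sum_(0 <= i < n) (i < m) * F i = \sum_(i < m) F i.
Proof.
move=> Hm; rewrite (big_cat_nat _ (n := m)) //= -[RHS]addn0; congr addn.
  rewrite big_mkord; apply: eq_bigr => i _; by rewrite ltn_ord mul1n.
by rewrite big_nat_cond big1 // => i /andP[/andP[Hi _] _]; rewrite ltnNge Hi.
Qed.

(** A downward closed set of naturals is the initial segment given by its cardinality, so counting
    replaces taking a maximum. *)
Lemma count_down (p : pred nat) n K : K <= n ->
  (forall y, y.+1 < K -> p y.+1 -> p y) ->
  let V := \sum_(0 <= y < n) ((y < K) && p y) in
  V <= K /\ forall y, y < K -> p y = (y < V).
Proof.
move=> HK Hp V; have -> : V = \sum_(y < K) p y.
  by rewrite -(sum_guard (fun y => p y : nat) HK); apply: eq_bigr => y _; rewrite mulnb.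
elim: K Hp {HK V} => [|K IH] Hp; first by rewrite big_ord0.
have [|IH1 IH2] := IH _; first by move=> y Hy; apply: Hp; exact: ltnW.
rewrite big_ord_recr /=; case E: (p K); last first.
  rewrite addn0; split=> [|y]; first exact: leqW.
  rewrite ltnS leq_eqVlt => /predU1P[->|]; last exact: IH2.
  by rewrite E ltnNge IH1.
have all_p y : y <= K -> p y.
  move=> Hy; rewrite -(subKn Hy); elim: (K - y) => [|d IHd]; first by rewrite subn0.
  case: (ltnP d K) => Hd; last by have -> : K - d.+1 = K - d by lia.
  by apply: Hp; [lia | have -> : (K - d.+1).+1 = K - d by lia].
have -> : \sum_(y < K) p y = K.
  rewrite (eq_bigr (fun=> 1)) ?sum1_card ?card_ord // => y _.
  by rewrite all_p // ltnW.
by rewrite addn1; split=> // y Hy; rewrite all_p.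
Qed.

(** Apply [count_down] to the complement. *)
Lemma count_up (p : pred nat) n K : K <= n ->
  (forall y, y.+1 < K -> p y -> p y.+1) ->
  let V := \sum_(0 <= y < n) ((y < K) && p y) in
  V <= K /\ forall y, y < K -> p y = (K - V <= y).
Proof.
move=> HK Hp V; have Hd y : y.+1 < K -> ~~ p y.+1 -> ~~ p y.
  by move=> Hy; apply: contraNN; exact: Hp.
have [H1 H2] := count_down (p := fun y => ~~ p y) HK Hd.
set V' := \sum_(0 <= y < n) _ in H1 H2.
have E : V + V' = K.
  rewrite -[RHS](sum_ltn HK) -big_split /=; apply: eq_bigr => y _.
  by case: (y < K); case: (p y).
split; first by lia.
move=> y Hy; have EV := H2 y Hy; have -> : K - V = V' by lia.
by rewrite leqNgt -EV negbK.
Qed.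

(** * Winning and paying, in rationals and in the formula *)

Section Equivalence.

Variables (Y : criterion) (w : seq symbol) (x : lobbying).
Hypotheses (Hf : format_ok w) (Hm : matches w x).

Local Notation m := (voters x).
Local Notation n := (issues x).

Let Em : code_voters w = m. Proof. by case: Hm. Qed.
Let En : code_issues w = n. Proof. by case: Hm. Qed.
Let Ek : code_level1 w = (level x).+1. Proof. by case: Hm. Qed.

Let bounds (i : 'I_m) (j : 'I_n) :
  [/\ m <= (size w).+2, n <= (size w).+2 & (level x).+1 <= (size w).+2].
Proof.
have [||B1 B2 B3] := @format_bounds w i j Hf; rewrite ?Em ?En ?ltn_ord //.
by rewrite Ek in B3; rewrite Em in B1; rewrite En in B2; split; lia.
Qed.

Let entry (i : 'I_m) (j : 'I_n) :
  [/\ 0 < code_den w i j, code_grid w i j <= (level x).+1, code_price w i j (code_grid w i j) = 0 &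
    code_grid w i j * code_den w i j = code_num w i j * (level x).+1].
Proof.
have [||b0 /and4P[Hab /eqP E /eqP E0 _]] := andP (@format_entry w i j Hf _ _);
  rewrite ?Em ?En ?ltn_ord //.
by rewrite Ek in E; split=> //; rewrite -(leq_pmul2r b0) E mulnC leq_mul2l Hab orbT.
Qed.

Let mono (i : 'I_m) (j : 'I_n) a b : a <= (level x).+1 -> b <= (level x).+1 ->
  (code_grid w i j <= a <= b) || (b <= a <= code_grid w i j) -> code_price w i j a <= code_price w i j b.
Proof.
by rewrite -Ek => Ha Hb; apply: format_mono; rewrite ?Em ?En ?ltn_ord.
Qed.

Let ord_g (i : 'I_m) (j : 'I_n) : 'I_(level x).+2 := inord (code_grid w i j).

Let ord_gE (i : 'I_m) (j : 'I_n) : ord_g i j = code_grid w i j :> nat.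
Proof. by have [_ H _ _] := entry i j; rewrite inordK. Qed.

Let probE (i : 'I_m) (j : 'I_n) : prob x i j = grid_value (ord_g i j).
Proof.
have [b0 Hg _ E] := entry i j; have [_ _ _ /(_ i j)[-> _] _] := Hm.
by apply/esym/eqP; rewrite grid_eq_frac // ord_gE E.
Qed.

Let priceE (i : 'I_m) (j : 'I_n) (a : 'I_(level x).+2) : price x i j a = code_price w i j a.
Proof. by have [_ _ _ /(_ i j)[_ ->] _] := Hm. Qed.

Let targetE (j : 'I_n) : target x j = code_target w j.
Proof. by have [_ _ _ _ [-> _ _]] := Hm. Qed.

Local Open Scope ring_scope.

(** Prices are natural numbers, so comparing them with d_j / m is the same as comparing them with
    its integer part. *)
Definition share (d : 'I_n -> rat) j : nat := Num.truncn (d j / m%:R).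

Let m_gt0 : 0 < m%:R :> rat.
Proof. by rewrite ltr0n voters_gt0. Qed.

Lemma affordableE d i j (a : 'I_(level x).+2) : 0 <= d j ->
  affordable d i j a = (code_price w i j a <= share d j)%N.
Proof.
move=> Hd; rewrite /affordable priceE /share truncn_ge_nat //.
by rewrite divr_ge0 // ltW.
Qed.

(** The farthest affordable index is reached by unit steps. Those counted by [code_support] lie on
    the wanted side of the original probability for free or are affordable; by monotone prices they
    form an initial segment if the target is 1 and a final segment if it is 0. *)
Lemma bribed_prob d i j : 0 <= d j ->
  vote_prob (target x j) (bribed d i j) =
  (code_support w i j (share d j))%:R / (level x).+1%:R.
Proof.
move=> Hd; have [_ _ HK] := bounds i j; have [_ Hg H0 _] := entry i j.
have Hmono := mono (i := i) (j := j).
rewrite /bribed mxE /code_support Ek -targetE; set c := share d j; set g := code_grid w i j in Hg H0 Hmono *.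
case: (target x j) => /=.
  have [|HV Hp] := @count_down (fun y => (y < g) || (code_price w i j y.+1 <= c))%N _ _ HK.
    move=> y Hy /orP[|Hc]; first by move/ltnW => ->.
    case: ltnP => //= Hgy; apply: leq_trans Hc; apply: Hmono; lia.
  set V := (\sum_(0 <= y < _) _)%N in HV Hp *.
  (* The count [V] is itself the farthest affordable index: it is not below the start [g], it is
     affordable, and no affordable index exceeds it. *)
  have gV : (g <= V)%N.
    by case: (posnP g) => [->//|g0]; rewrite -(prednK g0) -Hp ?prednK ?leqnn.
  have V_aff : (code_price w i j V <= c)%N.
    move: gV; rewrite leq_eqVlt => /predU1P[<-|gV]; first by rewrite H0.
    have V0 : (0 < V)%N by lia.
    have := Hp V.-1; rewrite !prednK // leqnn => /(_ HV) /orP[]; last by [].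
    lia.
  pose oV : 'I_(level x).+2 := Ordinal (HV : (V < (level x).+2)%N).
  rewrite -[RHS]/(grid_value oV); apply/le_anti/andP; split.
    apply/bigmax_leP; split; first by rewrite probE grid_le ord_gE.
    move=> a; rewrite probE !grid_le ord_gE affordableE // => /andP[Hga Hca] /=.
    case Ea : (nat_of_ord a) (ltn_ord a) Hca => [//|a'] Ha Hca.
    by rewrite -Hp // Hca orbT.
  apply: (@le_bigmax_cond _ _ _ _ oV) => //.
  by rewrite probE grid_le ord_gE affordableE // gV V_aff.
have [|HV Hp] := @count_up (fun y => (g <= y) || (code_price w i j y <= c))%N _ _ HK.
  move=> y Hy /orP[/leqW ->//|Hc]; case: leqP => //= Hgy.
  apply: leq_trans Hc; apply: Hmono; lia.
set V := (\sum_(0 <= y < _) _)%N in HV Hp *.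
set K := (level x).+1 in HV Hp Hg HK Hmono *.
(* For target 0 the lowest affordable index is the complement [U] of the count, and 1 - U / K = V /
   K. *)
pose U := (K - V)%N.
have gU : (U <= g)%N.
  move: Hg; rewrite leq_eqVlt => /predU1P[->|HgK]; first exact: leq_subr.
  by rewrite -Hp ?leqnn.
have U_aff : (code_price w i j U <= c)%N.
  move: gU; rewrite leq_eqVlt => /predU1P[->|gU]; first by rewrite H0.
  have UK : (U < K)%N by lia.
  by have := Hp U UK; rewrite leqnn => /orP[]; rewrite // leqNgt gU.
have HU : (U < (level x).+2)%N by rewrite ltnS leq_subr.
pose oU : 'I_(level x).+2 := Ordinal HU.
have -> : \big[Order.min/prob x i j]_(a < (level x).+2 |
    (grid_value a <= prob x i j) && affordable d i j a) grid_value a = grid_value oU.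
  apply/le_anti/andP; split.
    apply: (@bigmin_le_cond _ _ _ _ oU) => //.
    by rewrite probE grid_le ord_gE affordableE // gU U_aff.
  apply/bigmin_geP; split; first by rewrite probE grid_le ord_gE.
  move=> a; rewrite probE !grid_le ord_gE affordableE // => /andP[Hga Hca] /=.
  have := ltn_ord a; rewrite ltnS leq_eqVlt => /predU1P[->|Ha]; first exact: leq_subr.
  by rewrite -Hp // Hca orbT.
rewrite /grid_value /= -/K natrB //.
have K0 : K%:R != 0 :> rat by rewrite pnatr_eq0.
by field.
Qed.

Lemma won_wins d j : 0 <= d j -> won Y (bribed d) j = wins Y w j (share d j).
Proof.
move=> Hd; have i0 : 'I_m := Ordinal (voters_gt0 x).
have [Bm _ _] := bounds i0 j.
have [_ _ _ _ [_ _ Et]] := Hm.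
have tb0 : (0 < code_tden w)%N.
  by move: Hf; rewrite /format_ok => /and5P[_ _ _ _ /and5P[_ _ _ ->]].
rewrite /won /wins Em Ek; case: Y.
  have -> : #|[set i | favors (bribed d) i j]| = (\sum_(0 <= i < (size w).+2)
      ((i < m) && (code_tnum w * (level x).+1 < code_tden w * code_support w i j (share d j))))%N.
    under eq_bigr do rewrite -mulnb.
    rewrite (sum_guard _ Bm) -sum1_card big_mkcond /=; apply: eq_bigr => i _.
    rewrite inE /favors bribed_prob // Et frac_lt // [(code_support _ _ _ _ * _)%N]mulnC.
    by case: (_ < _)%N.
  by rewrite ltr_pdivrMr ?ltr0n // -natrM ltr_nat mulnC.
rewrite (eq_bigr (fun i : 'I_m => (code_support w i j (share d j))%:R / (level x).+1%:R)); last first.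
  by move=> i _; rewrite bribed_prob.
rewrite -mulr_suml -natr_sum -mulrA -invfM -natrM Et frac_lt ?muln_gt0 ?voters_gt0 //.
by rewrite (sum_guard _ Bm) [(code_tden w * _)%N]mulnC.
Qed.

Local Close Scope ring_scope.

(** The index |w| + 1 lies beyond the last token, so 0 is always among the numerals that the loops
    range over. It starts the maximisation in [wins_token]. *)
Lemma numeral_overflow : numeral w (size w).+1 0 = 0.
Proof.
move: Hf => /andP[/enc_surj [T ->] _]; rewrite numeral_word_of /token nth_default //.
by have := size_enc_ge T; lia.
Qed.

Lemma code_price_token (i : 'I_m) (j : 'I_n) a : a <= (level x).+1 ->
  exists2 q, q < (size w).+2 & code_price w i j a = numeral w q 0.
Proof.
move=> Ha; eexists; last by [].
have : num_tokens w = 3 + code_tail w by apply/eqP; case/and3P: Hf.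
have : num_tokens w <= size w.
  by move: Hf => /andP[/enc_surj [T ->] _]; rewrite num_tokens_word_of size_enc_ge.
rewrite /code_tail Em En Ek => HT ET.
have Hi := ltn_ord i; have Hj := ltn_ord j.
have Hij : i * n + j < m * n by nia.
have : (i * n + j).+1 * (level x).+2 <= m * n * (level x).+2 by rewrite leq_mul2r Hij orbT.
by rewrite mulSn; lia.
Qed.

Lemma wins_ext (j : 'I_n) c c' :
  (forall (i : 'I_m) a, a <= (level x).+1 -> (code_price w i j a <= c) = (code_price w i j a <= c')) ->
  wins Y w j c = wins Y w j c'.
Proof.
move=> Hc; have EV i : i < m -> code_support w i j c = code_support w i j c'.
  move=> Hi; apply: eq_bigr => y _; congr nat_of_bool; rewrite Ek.
  case: ltnP => //= Hy; rewrite !(Hc (Ordinal Hi)) //; exact: ltnW.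
rewrite /wins Em; case: Y; congr (_ < _ * _); apply: eq_bigr => i _.
  by case: ltnP => // Hi; rewrite EV.
by case: ltnP => // Hi; rewrite EV.
Qed.

(* Only the prices of the table matter, so the price may be lowered to one of
   them. *)
Lemma wins_token (j : 'I_n) c : wins Y w j c ->
  exists q, [/\ q < (size w).+2, wins Y w j (numeral w q 0) & numeral w q 0 <= c].
Proof.
have P0 : numeral w (@ord_max (size w).+1) 0 <= c by rewrite /= numeral_overflow.
(* Take the largest numeral not exceeding [c]: since every price is a numeral, the same prices lie
   below it as below [c]. *)
case: (@arg_maxnP 'I_(size w).+2 ord_max (fun q => numeral w q 0 <= c)
  (fun q => numeral w q 0) P0) => q Hq Hmax Hw.
exists q; split=> //; rewrite -(@wins_ext j c) // => i a Ha.
have [q' Hq' ->] := code_price_token i j Ha.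
apply/idP/idP => [H|H]; last exact: leq_trans H Hq.
exact: (Hmax (Ordinal Hq')).
Qed.

Lemma code_costP j q1 : q1 < (size w).+2 -> wins Y w j (numeral w q1 0) ->
  wins Y w j (code_cost Y w j) /\
  forall q, q < (size w).+2 -> wins Y w j (numeral w q 0) -> code_cost Y w j <= numeral w q 0.
Proof.
set N := (size w).+2 => Hq1 H1.
(* As [q] is below N, this number orders the pairs of value and index lexicographically; its
   minimiser is the only token that is [cheapest]. *)
pose rk (q : 'I_N) := numeral w q 0 * N + q.
case: (@arg_minnP 'I_N (Ordinal Hq1) (fun q => wins Y w j (numeral w q 0)) rk H1) => q0 H0 Hmin.
have Hc q : q < N -> wins Y w j (numeral w q 0) ->
    (numeral w q0 0 < numeral w q 0) || ((numeral w q0 0 == numeral w q 0) && (q0 <= q)).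
  move=> Hq Hw; have := Hmin (Ordinal Hq) Hw; rewrite /rk /= => H.
  have Hq0 := ltn_ord q0; case: (ltngtP (numeral w q0 0) (numeral w q 0)) => //= [Hlt|E].
    have : (numeral w q 0).+1 * N <= numeral w q0 0 * N by rewrite leq_mul2r Hlt orbT.
    by rewrite mulSn; lia.
  by rewrite E in H; lia.
have C0 : cheapest Y w j q0.
  by rewrite /cheapest H0; apply/forall_belowP => q Hq; apply/implyP; exact: Hc.
have -> : code_cost Y w j = numeral w q0 0.
  rewrite /code_cost (bigD1_seq (nat_of_ord q0)) ?iota_uniq ?mem_index_iota ?ltn_ord //=.
  rewrite C0 mul1n big_nat_cond big1 ?addn0 // => q /andP[/andP[_ Hq] Hne].
  case E : (cheapest Y w j q) => //; case/andP: E => Hw /forall_belowP /(_ q0 (ltn_ord q0)).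
  rewrite H0 /= => H; have := Hc q Hq Hw; move: H Hne; lia.
split=> // q Hq Hw; have := Hc q Hq Hw; case/orP => [/ltnW //|/andP[/eqP -> //]].
Qed.

Lemma lobby_equiv : (0 <= budget x)%R -> IB_lobbying Y x <-> lobby_ok Y w.
Proof.
move=> B0; have [_ _ _ _ [_ Eb _]] := Hm.
have m0 := voters_gt0 x.
have Bn : n <= (size w).+2.
  case: (posnP n) => [->//|n0].
  by have [_ -> _] := bounds (Ordinal m0) (Ordinal n0).
have share_ge0 (d : 'I_n -> rat) j : (0 <= d j)%R -> ((share d j)%:R * m%:R <= d j)%R.
  move=> Hd; rewrite -ler_pdivlMr // truncn_le //.
  by rewrite divr_ge0 // ltW.
rewrite /lobby_ok Em En (sum_guard _ Bn); split.
  case=> d [Hd Hsum Hwon].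
  have Hw (j : 'I_n) : wins Y w j (share d j) by rewrite -won_wins.
  apply/andP; split.
    apply/forall_belowP => j _; apply/implyP => Hj.
    have [q [Hq Hq' _]] := wins_token (Hw (Ordinal Hj)).
    by apply/negP => /forall_belowP /(_ q Hq); rewrite Hq'.
  rewrite -(ler_nat rat) natrM natr_sum mulr_sumr.
  have -> : ((code_budget w)%:R = (budget x)%:~R :> rat)%R by rewrite Eb -pmulrn.
  apply: le_trans Hsum; apply: ler_sum => j _.
  (* Per issue, d_j is at least m times the share, and the share wins, hence is at least
     [code_cost]. *)
  apply: le_trans (share_ge0 d j (Hd j)); rewrite mulrC ler_wpM2r ?ler0n // ler_nat.
  have [q [Hq Hq' Hle]] := wins_token (Hw j).
  have [_ Hmin] := code_costP Hq Hq'.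
  exact: leq_trans (Hmin q Hq Hq') Hle.
case/andP => /forall_belowP Hex Hsum.
have Hw (j : 'I_n) : wins Y w j (code_cost Y w j).
  have /Hex : j < (size w).+2 by apply: leq_trans Bn.
  rewrite ltn_ord /= => /allPn [q]; rewrite mem_iota add0n negbK => /andP[_ Hq] Hq'.
  by have [] := code_costP Hq Hq'.
(* A multiple of m makes the division among the voters exact, so each receives the computed cost. *)
pose d (j : 'I_n) : rat := (m * code_cost Y w j)%:R%R.
have Es (j : 'I_n) : share d j = code_cost Y w j.
  rewrite /share /d natrM mulrAC divff ?mul1r ?natrK //.
  by rewrite pnatr_eq0 -lt0n.
exists d; split.
- by move=> j; rewrite ler0n.
- rewrite -natr_sum -big_distrr /= Eb -pmulrn ler_nat; exact: Hsum.
- by move=> j; rewrite won_wins ?ler0n // Es.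
Qed.

End Equivalence.

Lemma language_formula Y w : formula Y w <-> IB_language Y w.
Proof.
split=> [/andP[Hf Hl]|[x [Hc HI]]].
  have /andP[/enc_surj [T Ew] _] := Hf; rewrite Ew in Hf Hl *.
  have [x [Hx Hm B0]] := format_code Hf.
  by exists x; split=> //; apply/(lobby_equiv Y Hf Hm B0).
(* In a yes-instance the budget bounds a sum of nonnegative amounts, so rejecting negative budgets
   in [format_ok] loses nothing. *)
have B0 : (0 <= budget x)%R.
  case: HI => d [Hd Hsum _]; rewrite -(ler0z rat).
  by apply: le_trans Hsum; apply: sumr_ge0 => j _.
have [a [b [ta [tb [Hab Ht ->]]]]] := (code_toks x w).1 Hc.
have Hf := toks_format_ok Hab Ht B0.
have Hm := toks_matches Hab Ht B0.
by rewrite /formula Hf; apply/(lobby_equiv Y Hf Hm B0).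
Qed.

Theorem theorem4p5 :
  polytime_decidable (IB_language StrictMajority) /\
  polytime_decidable (IB_language AverageMajority).
Proof.
by split; apply: formula_polytime => w; exact: language_formula.
Qed.
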